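(* Let $X$ be a smooth manifold and $H\in\Omega^3(X)$ a closed $3$-form. For every Dirac structure $L$ in the exact Courant algebroid $(TX\oplus T^*X)_H$ and every point $p\in X$, there exist an open neighborhood $U$ of $p$ and a Dirac structure $M$ in $(TU\oplus T^*U)_{i_U^*H}$ complementary to $L$ (that is, $L|_U\oplus M=TU\oplus T^*U$), where $i_U:U\to X$ denotes the inclusion.
   Context: For a manifold $X$ and a closed $3$-form $H$, $(TX\oplus T^*X)_H$ denotes the Courant algebroid $TX\oplus T^*X$ with pairing $\langle x+\alpha,y+\beta\rangle=\beta(x)+\alpha(y)$, anchor the projection to $TX$, and $H$-twisted Dorfman bracket on sections $[x+\alpha,y+\beta]_H=[x,y]+\mathcal{L}_x\beta-\iota_y d\alpha+\iota_y\iota_xH$. A subbundle $L\subseteq TX\oplus T^*X$ is lagrangian if $L=L^\perp$ with respect to the pairing; it is a Dirac structure if moreover $[\Gamma(L),\Gamma(L)]_H\subseteq\Gamma(L)$. Two lagrangian subbundles are complementary if their direct sum is the whole bundle. *)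

(* Defs.v *)
From HB Require Import structures.
From mathcomp Require Import all_boot all_order all_algebra.
From mathcomp Require Import all_classical all_reals all_analysis.
Import Order.TTheory GRing.Theory Num.Theory.
Import numFieldNormedType.Exports.

Set Implicit Arguments.
Unset Strict Implicit.
Unset Printing Implicit Defensive.

Local Open Scope classical_set_scope.
Local Open Scope ring_scope.

Definition partial (R : realType) (n : nat) (i : 'I_n)
    (f : 'rV[R]_n -> R) (u : 'rV[R]_n) : R :=
  'D_(delta_mx 0 i) f u.

Definition partials (R : realType) (n : nat) (s : seq 'I_n)
    (f : 'rV[R]_n -> R) : 'rV[R]_n -> R :=
  foldr (@partial R n) f s.

(* C^oo on an open set W: all iterated partial derivatives exist and are
   continuous on W. *)
Definition smooth (R : realType) (n : nat) (W : set 'rV[R]_n)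
    (f : 'rV[R]_n -> R) : Prop :=
  forall (s : seq 'I_n) (u : 'rV[R]_n), W u ->
    {for u, continuous (partials s f)} /\
    forall i : 'I_n, derivable (partials s f) u (delta_mx 0 i).

Definition smooth_map (R : realType) (n m : nat) (W : set 'rV[R]_n)
    (f : 'rV[R]_n -> 'rV[R]_m) : Prop :=
  forall j : 'I_m, smooth W (fun u => f u 0 j).

(* A homeomorphism from the open set [dom] onto an open subset of R^n;
   [crd] and its inverse [par] have junk values outside these sets. *)
Record chart (R : realType) (n : nat) (X : topologicalType) := Chart {
  dom : set X;
  crd : X -> 'rV[R]_n;
  par : 'rV[R]_n -> X;
  open_dom : open dom;
  open_img : open (crd @` dom);
  crdK : forall p, dom p -> par (crd p) = p;
  crd_continuous : {within dom, continuous crd};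
  par_continuous : {within crd @` dom, continuous par}
}.

Record manifold (R : realType) (n : nat) := Manifold {
  space :> topologicalType;
  idx : Type;
  atlas : idx -> chart R n space;
  space_hausdorff : hausdorff_space space;
  space_second_countable : @second_countable space;
  atlas_cover : forall p : space, exists a, dom (atlas a) p;
  atlas_smooth : forall a b,
    smooth_map (crd (atlas a) @` (dom (atlas a) `&` dom (atlas b)))
               (crd (atlas b) \o par (atlas a))
}.

(* The Jacobian matrix at p of the change of coordinates from chart a to
   chart b; its (i, j) entry is d(x_b^j)/d(x_a^i), so that it acts on row
   vectors from the right. *)
Definition transition_jac (R : realType) (n : nat) (X : manifold R n)
    (a b : idx X) (p : X) : 'M[R]_n :=
  jacobian (crd (atlas b) \o par (atlas a)) (crd (atlas a) p).

(* A (co)tangent vector at p is the family of its components in all the charts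
   around p, subject to the usual transformation law. To get a vector space
   without dependent types, such a family is extended by 0 to the charts whose
   domain does not contain p; hence [tangent p] and [cotangent p] are linear
   subspaces of [idx X -> 'rV[R]_n]. *)
Definition tangent (R : realType) (n : nat) (X : manifold R n) (p : X) :
    set (idx X -> 'rV[R]_n) :=
  [set v | (forall a, ~ dom (atlas a) p -> v a = 0) /\
    forall a b, dom (atlas a) p -> dom (atlas b) p ->
      v b = v a *m transition_jac a b p].

Definition cotangent (R : realType) (n : nat) (X : manifold R n) (p : X) :
    set (idx X -> 'rV[R]_n) :=
  [set v | (forall a, ~ dom (atlas a) p -> v a = 0) /\
    forall a b, dom (atlas a) p -> dom (atlas b) p ->
      v a = v b *m (transition_jac a b p)^T].

Definition gvec (R : realType) (n : nat) (X : manifold R n) : Type :=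
  ((idx X -> 'rV[R]_n) * (idx X -> 'rV[R]_n))%type.

Definition gtangent (R : realType) (n : nat) (X : manifold R n) (p : X) :
    set (gvec X) :=
  tangent p `*` cotangent p.

(* <x + alpha, y + beta> = beta(x) + alpha(y), computed in the chart a; the
   value is the same in all charts around the base point. *)
Definition pairing (R : realType) (n : nat) (X : manifold R n) (a : idx X)
    (e f : gvec X) : R :=
  \sum_(i < n) f.2 a 0 i * e.1 a 0 i + \sum_(i < n) e.2 a 0 i * f.1 a 0 i.

Definition orthogonal_at (R : realType) (n : nat) (X : manifold R n) (p : X)
    (e f : gvec X) : Prop :=
  forall a, dom (atlas a) p -> pairing a e f = 0.

(* For an open U, objects "over U" are functions on X of which only the values
   at the points of U matter. The charts of the open submanifold U are the
   restrictions of those of X, so T_pU = T_pX for p in U, and these are exactly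
   the corresponding objects of the manifold U. *)

Definition smooth_over (R : realType) (n : nat) (X : manifold R n)
    (U : set X) (v : X -> idx X -> 'rV[R]_n) : Prop :=
  forall a, smooth_map (crd (atlas a) @` (dom (atlas a) `&` U))
                       (fun u => v (par (atlas a) u) a).

Definition is_section (R : realType) (n : nat) (X : manifold R n)
    (U : set X) (e : X -> gvec X) : Prop :=
  [/\ forall p, U p -> gtangent p (e p),
      smooth_over U (fun p => (e p).1) &
      smooth_over U (fun p => (e p).2)].

(* [H p a i j k] is the component H(d_i, d_j, d_k) at p in the chart a. *)
Definition tensor3 (R : realType) (n : nat) (X : manifold R n) : Type :=
  X -> idx X -> 'I_n -> 'I_n -> 'I_n -> R.

Definition is_3form (R : realType) (n : nat) (X : manifold R n)
    (H : tensor3 X) : Prop :=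
  [/\ forall p a b, dom (atlas a) p -> dom (atlas b) p -> forall i j k,
        H p a i j k =
          \sum_(i' < n) \sum_(j' < n) \sum_(k' < n)
            transition_jac a b p i i' * transition_jac a b p j j' *
            transition_jac a b p k k' * H p b i' j' k',
      forall p a, dom (atlas a) p -> forall i j k,
        H p a i j k = - H p a j i k /\ H p a i j k = - H p a i k j &
      forall a i j k,
        smooth (crd (atlas a) @` dom (atlas a))
               (fun u => H (par (atlas a) u) a i j k)].

Definition closed_3form (R : realType) (n : nat) (X : manifold R n)
    (H : tensor3 X) : Prop :=
  forall a p, dom (atlas a) p -> forall i j k l : 'I_n,
    let Ha i j k := fun u => H (par (atlas a) u) a i j k in
    let u := crd (atlas a) p in
    partial i (Ha j k l) u - partial j (Ha i k l) u
      + partial k (Ha i j l) u - partial l (Ha i j k) u = 0.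

(* [x, y]^i = x^j d_j y^i - y^j d_j x^i *)
Definition lie_bracket (R : realType) (n : nat)
    (x y : 'rV[R]_n -> 'rV[R]_n) (u : 'rV[R]_n) : 'rV[R]_n :=
  \row_i \sum_(j < n) (x u 0 j * partial j (fun w => y w 0 i) u
                       - y u 0 j * partial j (fun w => x w 0 i) u).

(* (L_x beta)_i = x^j d_j beta_i + beta_j d_i x^j *)
Definition lie_derivative (R : realType) (n : nat)
    (x beta : 'rV[R]_n -> 'rV[R]_n) (u : 'rV[R]_n) : 'rV[R]_n :=
  \row_i \sum_(j < n) (x u 0 j * partial j (fun w => beta w 0 i) u
                       + beta u 0 j * partial i (fun w => x w 0 j) u).

(* (d alpha)_ij = d_i alpha_j - d_j alpha_i *)
Definition ext_deriv (R : realType) (n : nat)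
    (alpha : 'rV[R]_n -> 'rV[R]_n) (u : 'rV[R]_n) : 'M[R]_n :=
  \matrix_(i, j) (partial i (fun w => alpha w 0 j) u
                  - partial j (fun w => alpha w 0 i) u).

(* (iota_x omega)_j = omega(x, d_j) for a 2-form omega *)
Definition contract2 (R : realType) (n : nat) (x : 'rV[R]_n)
    (omega : 'M[R]_n) : 'rV[R]_n :=
  \row_j \sum_(i < n) x 0 i * omega i j.

(* (iota_x h)_jk = h(x, d_j, d_k) for a 3-form h *)
Definition contract3 (R : realType) (n : nat) (x : 'rV[R]_n)
    (h : 'I_n -> 'I_n -> 'I_n -> R) : 'M[R]_n :=
  \matrix_(j, k) \sum_(i < n) x 0 i * h i j k.

(* The section [x + alpha, y + beta]_H of TX (+) T*X, given by its components
   in each chart. *)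
Definition dorfman (R : realType) (n : nat) (X : manifold R n)
    (H : tensor3 X) (e f : X -> gvec X) (p : X) : gvec X :=
  let x a := fun u => (e (par (atlas a) u)).1 a in
  let alpha a := fun u => (e (par (atlas a) u)).2 a in
  let y a := fun u => (f (par (atlas a) u)).1 a in
  let beta a := fun u => (f (par (atlas a) u)).2 a in
  (fun a => if p \in dom (atlas a) then
      lie_bracket (x a) (y a) (crd (atlas a) p)
    else 0,
   fun a => if p \in dom (atlas a) then
      let u := crd (atlas a) p in
      lie_derivative (x a) (beta a) u
      - contract2 (y a u) (ext_deriv (alpha a) u)
      + contract2 (y a u) (contract3 (x a u) (H p a))
    else 0).

(* Smooth subbundle of (TX (+) T*X)|_U: the fibres are spanned by local frames
   of smooth sections. *)
Definition is_subbundle (R : realType) (n : nat) (X : manifold R n)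
    (U : set X) (L : X -> set (gvec X)) : Prop :=
  forall p, U p ->
    exists (V : set X) (k : nat) (s : 'I_k -> X -> gvec X),
      [/\ open V, V p, V `<=` U,
          forall i, is_section V (s i) &
          forall q, V q ->
            (forall e, L q e <->
               exists c : 'I_k -> R, e = \sum_(i < k) c i *: s i q) /\
            (forall c : 'I_k -> R,
               \sum_(i < k) c i *: s i q = 0 -> forall i, c i = 0)].

Definition is_lagrangian (R : realType) (n : nat) (X : manifold R n)
    (U : set X) (L : X -> set (gvec X)) : Prop :=
  is_subbundle U L /\
  forall p, U p ->
    L p = [set e | gtangent p e /\ forall f, L p f -> orthogonal_at p e f].

Definition is_section_of (R : realType) (n : nat) (X : manifold R n)
    (U : set X) (L : X -> set (gvec X)) (e : X -> gvec X) : Prop :=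
  is_section U e /\ forall p, U p -> L p (e p).

(* Closedness of Gamma(L) refers to sections over the whole of U; H at the points
   of U is the pullback of H along the inclusion of U. *)
Definition is_dirac (R : realType) (n : nat) (X : manifold R n)
    (U : set X) (H : tensor3 X) (L : X -> set (gvec X)) : Prop :=
  is_lagrangian U L /\
  forall e f, is_section_of U L e -> is_section_of U L f ->
    is_section_of U L (dorfman H e f).

Definition complementary (R : realType) (n : nat) (X : manifold R n)
    (U : set X) (L M : X -> set (gvec X)) : Prop :=
  forall p, U p ->
    L p `&` M p = [set 0] /\
    gtangent p = [set e | exists l m, [/\ L p l, M p m & e = l + m]].

(* Main.v *)
Require Import Defs.
From HB Require Import structures.
From mathcomp Require Import all_boot all_order all_algebra.
From mathcomp Require Import all_classical all_reals all_analysis.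
From mathcomp Require Import ring lra.
Import Order.TTheory GRing.Theory Num.Theory.
Import numFieldNormedType.Exports.

Set Implicit Arguments.
Unset Strict Implicit.
Unset Printing Implicit Defensive.

Local Open Scope classical_set_scope.
Local Open Scope ring_scope.

(* Work in a chart around [p]. By the Poincare lemma there is a 2-form B near p
   with dB = H and B(p) = 0, and the shear x + alpha |-> x + alpha + iota_x B
   carries the H-twisted Dorfman bracket to the untwisted one. For the latter
   every lagrangian subspace of R^n (+) R^n*, extended with constant coefficients,
   is a Dirac structure, because isotropy of the fibres can be differentiated.
   Swapping the two summands of R^n (+) R^n* maps the fibre of L at p to a
   lagrangian complement (its Euclidean orthogonal). The constant extension of
   that complement, sheared back by B, is M: it is complementary to L at p, hence
   near p. *)

(** * Smooth functions *)

(** Taking the apex of the cone operator at the coordinates of [p] is what makes B vanish there: the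
    shear is then the identity over [p], and complementarity at [p] becomes the nonvanishing of a
    Gram determinant of a positive definite form, an open condition. M is described by equations,
    orthogonality to a constant frame after the shear. Membership of a bracket in M is then a scalar
    identity, obtained by differentiating other scalar identities, with no varying coefficients to
    carry along. Two obstacles shape the rest. Smoothness speaks of all iterated partial
    derivatives, so it is proved by exhibiting classes of functions stable under differentiation;
    for B such a class consists of the integrals over [0, 1] of t^k h(c + t (u - c)) with k free,
    since each derivative raises k by one. And vectors are compatible families over all charts, so
    the bracket, given by a formula in each chart, must be shown to obey the transformation laws;
    there the second derivatives of coordinate changes cancel by Clairaut's theorem. *)

(* A sealed copy of [partial]: conversion would otherwise unfold distinct
   partial derivatives down to limits when it compares them. *)
Fact pderiv_key : unit. Proof. exact: tt. Qed.
Definition pderiv (R : realType) (n : nat) := locked_with pderiv_key (@partial R n).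

Lemma partialE (R : realType) (n : nat) : @partial R n = @pderiv R n.
Proof. by rewrite /pderiv unlock. Qed.

Lemma pderivE (R : realType) (n : nat) (i : 'I_n) (f : 'rV[R]_n -> R) u :
  pderiv i f u = 'D_(delta_mx 0 i) f u.
Proof. by rewrite -partialE. Qed.

(** * Restriction to lines and mean value estimates *)

Section lines.
Context {R : realType} {V : normedModType R}.

Let growth_line (f : V -> R) (x v : V) (t : R) :
  (fun h => h^-1 *: (((fun s => f (x + s *: v)) \o shift t) (h *: 1)
            - f (x + t *: v))) =
  (fun h => h^-1 *: ((f \o shift (x + t *: v)) (h *: v) - f (x + t *: v))).
Proof.
apply/funext => h; rewrite /= /shift /=.
have -> : h%:A = h :> R by exact: mulr1.
by rewrite scalerDl addrCA.
Qed.

Lemma derivable_line (f : V -> R) (x v : V) (t : R) :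
  derivable (fun s : R => f (x + s *: v)) t 1 = derivable f (x + t *: v) v.
Proof. by rewrite /derivable growth_line. Qed.

Lemma derive_line (f : V -> R) (x v : V) (t : R) :
  'D_1 (fun s : R => f (x + s *: v)) t = 'D_v f (x + t *: v).
Proof. by rewrite /derive growth_line. Qed.

Lemma is_derive_line (f : V -> R) (x v : V) (t : R) :
  derivable f (x + t *: v) v ->
  is_derive t 1 (fun s => f (x + s *: v)) ('D_v f (x + t *: v)).
Proof. by move=> d; split; [rewrite derivable_line | exact: derive_line]. Qed.

(** The increment is a little-o of [h], so the differential exists and is zero. Subtracting the
    candidate linear part reduces the general case to this one. *)
Lemma differentiable_remainder (f : V -> R) (x : V) :
  (forall e, 0 < e -> \forall h \near (0 : V), `|f (x + h) - f x| <= e * `|h|) ->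
  differentiable f x.
Proof.
move=> H; have H' : f \o shift x = cst (f x) + (\0 : V -> R) +o_ (0 : V) id.
  apply/eqaddoP => e e0; near=> h; rewrite /= !fctE /= addr0.
  by rewrite [h + x]addrC; near: h; exact: H.
have c0 : continuous (\0 : V -> R) by move=> y; exact: cvg_cst.
apply/diff_locallyP; rewrite (diff_unique c0 H'); split => //.
Unshelve. all: by end_near. Qed.

Lemma continuous_dist_le (f : V -> R) (x : V) :
  (forall e, 0 < e -> \forall y \near x, `|f x - f y| <= e) ->
  {for x, continuous f}.
Proof. by move=> H; apply/cvgrPdist_le => e; exact: H. Qed.

End lines.

(** Allowing either sign of [a], and [a = 0], lets the coordinates of an arbitrary vector serve as
    step lengths. *)
Lemma MVT0 (R : realType) (g dg : R -> R) (a : R) :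
  (forall s : R, `|s| <= `|a| -> is_derive s 1 g (dg s)) ->
  exists2 c, `|c| <= `|a| & g a - g 0 = dg c * a.
Proof.
move=> H.
have cg s : `|s| <= `|a| -> {for s, continuous g}.
  move=> /H [d _]; exact/differentiable_continuous/derivable1_diffP.
have [a0|a0|->] := ltgtP a 0; last first.
- by exists 0 => //; rewrite mulr0 subrr.
- have [c cI E] : exists2 c, c \in `]0, a[%R & g a - g 0 = dg c * (a - 0).
    apply: MVT => // [s|].
      rewrite in_itv /= => /andP[s0 sa]; apply: H.
      by rewrite !gtr0_norm // ltW.
    apply: continuous_in_subspaceT => s; rewrite inE /= in_itv /= => /andP[s0 sa].
    by apply: cg; rewrite ger0_norm // gtr0_norm.
  exists c; last by rewrite E subr0.
  by move: cI; rewrite in_itv /= => /andP[s0 sa]; rewrite !gtr0_norm // ltW.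
- have [c cI E] : exists2 c, c \in `]a, 0[%R & g 0 - g a = dg c * (0 - a).
    apply: MVT => // [s|].
      rewrite in_itv /= => /andP[s0 sa]; apply: H.
      by rewrite !ltr0_norm // lerN2 ltW.
    apply: continuous_in_subspaceT => s; rewrite inE /= in_itv /= => /andP[s0 sa].
    by apply: cg; rewrite ler0_norm // ltr0_norm // lerN2.
  exists c; last by rewrite -opprB E sub0r mulrN opprK.
  by move: cI; rewrite in_itv /= => /andP[s0 sa]; rewrite !ltr0_norm // lerN2 ltW.
Qed.

Section rows.
Context {R : realType} {n : nat}.
Implicit Types (u v h : 'rV[R]_n) (f g : 'rV[R]_n -> R).

Local Notation e_ i := (delta_mx 0 i : 'rV[R]_n).

Lemma coord_norm_le h (i : 'I_n) : `|h 0 i| <= `|h|.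
Proof.
rewrite [leRHS]/Num.Def.normr /= mx_normrE.
exact: (le_bigmax _ (fun k : 'I_1 * 'I_n => `|h k.1 k.2|) (0, i)).
Qed.

Lemma row_norm_le h (r : R) : 0 <= r -> (forall i, `|h 0 i| <= r) -> `|h| <= r.
Proof.
move=> r0 H; rewrite [leLHS]/Num.Def.normr /= mx_normrE.
by apply: bigmax_le => // -[i j] _ /=; rewrite ord1.
Qed.

Lemma pderiv_line f u (i : 'I_n) (t : R) :
  derivable f (u + t *: e_ i) (e_ i) ->
  is_derive t 1 (fun s => f (u + s *: e_ i)) (pderiv i f (u + t *: e_ i)).
Proof. by rewrite pderivE; exact: is_derive_line. Qed.

Lemma near_pderiv f g u (i : 'I_n) :
  (\near u, f u = g u) -> pderiv i f u = pderiv i g u.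
Proof. by rewrite !pderivE; exact: near_eq_derive. Qed.

(** The increment telescopes along a path that changes one coordinate at a time, and the mean value
    theorem controls each step. With [d] the partial derivatives at [u] this gives
    differentiability; with [d = 0] it gives a Lipschitz bound. *)
Lemma increment_le f u h (d : 'I_n -> R) (e : R) : 0 <= e ->
  (forall v, `|v - u| <= `|h| -> forall i,
     derivable f v (e_ i) /\ `|pderiv i f v - d i| <= e) ->
  `|f (u + h) - f u - \sum_i h 0 i * d i| <= n%:R * e * `|h|.
Proof.
move=> e0 H.
(* [hk k] keeps the first [k] coordinates of [h]. *)
pose hk k : 'rV[R]_n := \row_j (if (j < k)%N then h 0 j else 0).
have hkn : hk n = h by apply/rowP => j; rewrite mxE ltn_ord.
rewrite -{1}hkn.
suff: forall k, (k <= n)%N ->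
   `|f (u + hk k) - f u - \sum_(i < n | (i < k)%N) h 0 i * d i| <= k%:R * e * `|h|.
  move/(_ n (leqnn n)); congr (`|_ - _| <= _).
  by apply: eq_bigl => i; rewrite ltn_ord.
elim=> [_|k IH kn].
  rewrite big_pred0 // subr0 !mul0r.
  suff -> : hk 0 = 0 by rewrite addr0 subrr normr0.
  by apply/rowP => j; rewrite !mxE.
pose K := Ordinal kn.
have hS : hk k.+1 = hk k + h 0 K *: e_ K.
  apply/rowP => j; rewrite !mxE eqxx /= ltnS leq_eqVlt.
  have [->|jK] := eqVneq j K; first by rewrite eqxx ltnn /= add0r mulr1.
  have -> : (nat_of_ord j == k) = false by apply/negbTE; move: jK.
  by rewrite mulr0 addr0.
(* The norm is the sup norm, so no intermediate point is further from [u] than [u + h]. *)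
have sH s : `|s| <= `|h 0 K| -> `|u + hk k + s *: e_ K - u| <= `|h|.
  move=> sle; rewrite addrAC [u + _]addrC addrK.
  apply: row_norm_le => // j; rewrite !mxE eqxx /=.
  have [->|jK] := eqVneq j K.
    by rewrite /= ltnn add0r mulr1 (le_trans sle) ?coord_norm_le.
  rewrite mulr0 addr0; case: ifP => _; last by rewrite normr0.
  exact: coord_norm_le.
have [c cle E] := @MVT0 R (fun s => f (u + hk k + s *: e_ K))
   (fun s => pderiv K f (u + hk k + s *: e_ K)) (h 0 K)
   (fun s sle => pderiv_line (H _ (sH s sle) K).1).
rewrite (bigD1 K) ?ltnS //=.
rewrite (eq_bigl (fun i : 'I_n => (i < k)%N)) => [|i]; last first.
  rewrite ltnS ltn_neqAle andbC; congr (_ && _).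
rewrite scale0r addr0 in E.
have -> : f (u + hk k.+1) - f u - (h 0 K * d K + \sum_(i < n | (i < k)%N) h 0 i * d i)
  = (f (u + hk k) - f u - \sum_(i < n | (i < k)%N) h 0 i * d i)
   + (pderiv K f (u + hk k + c *: e_ K) - d K) * h 0 K.
  rewrite mulrBl -E hS addrA; ring.
rewrite -natr1 [(_ + 1) * e]mulrDl [_ * `|h|]mulrDl mul1r (le_trans (ler_normD _ _)) //.
apply: lerD; first exact/IH/ltnW.

by rewrite normrM ler_pM // ?coord_norm_le // (H _ (sH c cle) K).2.
Qed.

(** Subtracting the linear map [l] built from the partial derivatives at [u] leaves a function whose
    partial derivatives are small near [u], hence one with little-o increments. *)
Lemma differentiable_pderiv f u :
  (\forall v \near u, forall i, derivable f v (e_ i)) ->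
  (forall i, {for u, continuous (pderiv i f)}) -> differentiable f u.
Proof.
move=> df cf.
pose l v := \sum_(i < n) v 0 i * pderiv i f u.
have dl x : differentiable (l : 'rV[R]_n -> R) x.
  rewrite /l (_ : (fun v => _) =
    \sum_(i < n) (fun v : 'rV[R]_n => v 0 i * pderiv i f u)); last first.
    by apply/funext => v; rewrite fct_sumE.
  apply: differentiable_sum => i; apply: differentiableM => //.
  exact: differentiable_coord.
suff: differentiable (f - l) u.
  move=> dfl; rewrite (_ : f = (f - l) + l); first exact: differentiableD.
  by apply/funext => v; rewrite !fctE subrK.
apply: differentiable_remainder => e e0.
(* The estimate sums [n] errors; [n.+1] replaces [n] so that the quotient also makes sense in
   dimension 0. *)
have n0 : 0 < n.+1%:R^-1 * e :> R by rewrite mulr_gt0 ?invr_gt0 ?ltr0n.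
have near_all : \forall v \near u, forall i : 'I_n,
    derivable f v (e_ i) /\ `|pderiv i f v - pderiv i f u| <= n.+1%:R^-1 * e.
  have A : \forall v \near u, forall i : 'I_n,
      `|pderiv i f v - pderiv i f u| <= n.+1%:R^-1 * e.
    apply: (@filter_forall _ 'I_n
      (fun i v => `|pderiv i f v - pderiv i f u| <= n.+1%:R^-1 * e) _
      (nbhs_filter u)) => i.
    move: (cf i) => /cvgrPdist_le /(_ _ n0).
    by apply: filterS => v; rewrite distrC.
  by apply: filterS2 df A => v dv pv i; split.
move: near_all => /nbhs_ballP[r /= r0 rP].
apply/nbhs_ballP; exists r => // h; rewrite -ball_normE /= sub0r normrN => hr.
have := @increment_le f u h (fun i => pderiv i f u) (n.+1%:R^-1 * e) (ltW n0).
move=> /(_ _)/le_trans; rewrite !fctE.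
have -> : f (u + h) - l (u + h) - (f u - l u) =
   f (u + h) - f u - \sum_i h 0 i * pderiv i f u.
  have -> : l (u + h) = l u + \sum_i h 0 i * pderiv i f u.
    by rewrite /l -big_split /=; apply: eq_bigr => i _; rewrite mxE mulrDl.
  ring.
apply.
  move=> v vh; apply: rP; rewrite -ball_normE /= distrC; exact: le_lt_trans hr.
rewrite ler_wpM2r // mulrA ler_piMl ?(ltW e0) //.
have n1 : 0 < n.+1%:R :> R by rewrite ltr0n.
by rewrite -[leRHS](divff (lt0r_neq0 n1)) ler_pM2r ?invr_gt0 // ler_nat.
Qed.

End rows.

Lemma near_eq_continuous (T U : topologicalType) (f g : T -> U) (u : T) :
  (\near u, f u = g u) -> {for u, continuous f} -> {for u, continuous g}.
Proof.
move=> fg cf; rewrite /prop_for /continuous_at -(nbhs_singleton fg).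
by apply: cvg_trans cf; exact: near_eq_cvg.
Qed.

(** * Chain and product rules *)

Lemma derive_pderiv (R : realType) (n : nat) (f : 'rV[R]_n -> R) u v : differentiable f u ->
  'D_v f u = \sum_(i < n) v 0 i * pderiv i f u.
Proof.
move=> df; rewrite deriveE // {1}[v]row_sum_delta linear_sum /=.
apply: eq_bigr => i _; rewrite linearZ /=; congr (_ * _).
by rewrite pderivE deriveE.
Qed.

Section chain_rule.
Context {R : realType} {n m : nat}.

Local Notation e_ i := (delta_mx 0 i : 'rV[R]_n).

Lemma differentiable_row (phi : 'rV[R]_n -> 'rV[R]_m) u :
  (forall j, differentiable (fun w => phi w 0 j) u) -> differentiable phi u.
Proof.
move=> d; rewrite (_ : phi =
    \sum_(j < m) (fun w => phi w 0 j *: (delta_mx 0 j : 'rV[R]_m))); last first.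
  by apply/funext => w; rewrite fct_sumE -row_sum_delta.
by apply: differentiable_sum => j; exact: differentiableZl.
Qed.

Lemma jacobianE (phi : 'rV[R]_n -> 'rV[R]_m) u :
  (forall j, differentiable (fun w => phi w 0 j) u) ->
  jacobian phi u = \matrix_(i, j) pderiv i (fun w => phi w 0 j) u.
Proof.
move=> d; have D := differentiable_row d.
apply/row_matrixP => i; rewrite rowE -(deriveEjacobian _ D).
rewrite derive_mx; last exact: diff_derivable.
by apply/rowP => j; rewrite !mxE pderivE.
Qed.

Lemma pderiv_comp (g : 'rV[R]_m -> R) (phi : 'rV[R]_n -> 'rV[R]_m) u i :
  differentiable g (phi u) -> (forall j, differentiable (fun w => phi w 0 j) u) ->
  pderiv i (g \o phi) u =
  \sum_l pderiv i (fun w => phi w 0 l) u * pderiv l g (phi u).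
Proof.
move=> dg d; have D := differentiable_row d.
rewrite pderivE deriveE; last exact: differentiable_comp.
rewrite diff_comp //= -(deriveE _ D) -(deriveE _ dg) derive_pderiv //.
by rewrite derive_mx; [apply: eq_bigr => l _; rewrite mxE (pderivE i) | exact: diff_derivable].
Qed.

Lemma pderiv_cst (c : R) (i : 'I_n) u : pderiv i (cst c) u = 0.
Proof. by rewrite pderivE; exact: derive_cst. Qed.

Lemma pderiv_coord (i j : 'I_n) u :
  pderiv i (fun w : 'rV[R]_n => w 0 j) u = (j == i)%:R.
Proof.
have /matrixP/(_ 0 j) := @derive_mx R 'rV[R]_n 1 n id u (e_ i) (@derivable_id _ _ _ _).
by rewrite pderivE derive_id !mxE eqxx.
Qed.

End chain_rule.

Section derivation_rules.
Context {R : realType} {n : nat}.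
Implicit Types (f g : 'rV[R]_n -> R).

Local Notation e_ i := (delta_mx 0 i : 'rV[R]_n).

Lemma derivable_coord (i j : 'I_n) u : derivable (fun w : 'rV[R]_n => w 0 j) u (e_ i).
Proof. by apply: diff_derivable; exact: differentiable_coord. Qed.

Lemma pderivD f g u i : derivable f u (e_ i) -> derivable g u (e_ i) ->
  pderiv i (fun w => f w + g w) u = pderiv i f u + pderiv i g u.
Proof. by move=> df dg; rewrite !pderivE -deriveD. Qed.

Lemma pderivM f g u i : derivable f u (e_ i) -> derivable g u (e_ i) ->
  pderiv i (fun w => f w * g w) u = f u * pderiv i g u + g u * pderiv i f u.
Proof. by move=> df dg; rewrite !pderivE [LHS]deriveM. Qed.

Lemma pderiv_sumM (m : nat) (f g : 'I_m -> 'rV[R]_n -> R) u i :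
  (forall l, derivable (f l) u (e_ i)) -> (forall l, derivable (g l) u (e_ i)) ->
  pderiv i (fun w => \sum_l f l w * g l w) u =
  \sum_l (f l u * pderiv i (g l) u + g l u * pderiv i (f l) u).
Proof.
move=> df dg; rewrite pderivE (_ : (fun w => _) = \sum_l (f l * g l)); last first.
  by apply/funext => w; rewrite fct_sumE.
rewrite derive_sum => [|l]; last exact: derivableM.
by apply: eq_bigr => l _; rewrite -pderivM // pderivE.
Qed.

Lemma derivable_sumM (m : nat) (f g : 'I_m -> 'rV[R]_n -> R) u i :
  (forall l, derivable (f l) u (e_ i)) -> (forall l, derivable (g l) u (e_ i)) ->
  derivable (fun w => \sum_l f l w * g l w) u (e_ i).
Proof.
move=> df dg; rewrite (_ : (fun w => _) = \sum_l (f l * g l)); last first.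
  by apply/funext => w; rewrite fct_sumE.
by apply: derivable_sum => l; apply: derivableM; [exact: df|exact: dg].
Qed.

End derivation_rules.

(* Sealed for the same reason as [pderiv]. *)
Fact csmooth_key : unit. Proof. exact: tt. Qed.
Definition csmooth (R : realType) (n : nat) := locked_with csmooth_key (@smooth R n).

Lemma smoothE (R : realType) (n : nat) : @smooth R n = @csmooth R n.
Proof. by rewrite /csmooth unlock. Qed.

Lemma smooth_mapE (R : realType) (n m : nat) (W : set 'rV[R]_n)
    (f : 'rV[R]_n -> 'rV[R]_m) :
  smooth_map W f <-> forall j, csmooth W (fun u => f u 0 j).
Proof. by rewrite /smooth_map smoothE. Qed.

(** * Closure properties of smooth functions *)

Section smooth_functions.
Context {R : realType} {n : nat}.
Implicit Types (W : set 'rV[R]_n) (f g : 'rV[R]_n -> R).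

Local Notation e_ i := (delta_mx 0 i : 'rV[R]_n).

(** A coinduction principle: since [W] is open, equality on [W] survives a partial derivative, so
    every iterated derivative agrees on [W] with a member of [P]. It replaces inductions over lists
    of derivatives for products, composites and integrals. *)
Lemma smooth_coind W (P : ('rV[R]_n -> R) -> Prop) : open W ->
  (forall f, P f -> [/\ forall u, W u -> {for u, continuous f},
     forall u i, W u -> derivable f u (e_ i) &
     forall i, exists2 g, P g & forall u, W u -> pderiv i f u = g u]) ->
  forall f, P f -> csmooth W f.
Proof.
move=> oW HP f Pf; rewrite -smoothE.
have nW u (A : 'rV[R]_n -> Prop) : W u -> (forall w, W w -> A w) -> \near u, A u.
  by move=> Wu H; apply: filterS (open_nbhs_nbhs (conj oW Wu)).
have main s : exists2 g, P g & forall u, W u -> partials s f u = g u.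
  elim: s => [|i s [g Pg E]] /=; first by exists f.
  have [_ _ /(_ i)[h Ph Eh]] := HP _ Pg; exists h => // u Wu.
  by rewrite -Eh // partialE; apply: near_pderiv; exact: nW.
move=> s u Wu; have [g /HP[cg dg _] E] := main s; split.
  apply: near_eq_continuous (cg u Wu).
  by apply: nW => // w /E ->.
move=> i; apply: (@near_eq_derivable _ _ _ g); last exact: dg.
by apply: nW => // w /E ->.
Qed.

Lemma smooth_continuous W f u : csmooth W f -> W u -> {for u, continuous f}.
Proof. by rewrite -smoothE => sf /(sf [::])[]. Qed.

Lemma smooth_derivable W f u i : csmooth W f -> W u -> derivable f u (e_ i).
Proof. by rewrite -smoothE => sf /(sf [::])[_]; exact. Qed.

Lemma smooth_pderiv W f i : csmooth W f -> csmooth W (pderiv i f).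
Proof.
(* [partials] is a [foldr], so the derivative taken first is the last entry of the list. *)
rewrite -smoothE => sf s u Wu; have := sf (rcons s i) u Wu.
by rewrite /partials foldr_rcons partialE.
Qed.

Lemma smooth_sub W W' f : W' `<=` W -> csmooth W f -> csmooth W' f.
Proof. by rewrite -smoothE => WW' sf s u /WW'; exact: sf. Qed.

Lemma smooth_eq W f g : open W -> (forall u, W u -> f u = g u) ->
  csmooth W f -> csmooth W g.
Proof.
move=> oW fg sf.
have nW u (A : 'rV[R]_n -> Prop) : W u -> (forall w, W w -> A w) -> \near u, A u.
  by move=> Wu H; apply: filterS (open_nbhs_nbhs (conj oW Wu)).
apply: (@smooth_coind W (fun g =>
  exists2 f, csmooth W f & forall u, W u -> f u = g u)) => //; last by exists f.
move=> {f fg sf}h [f sf E]; split.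
- move=> u Wu; apply: near_eq_continuous (smooth_continuous sf Wu).
  exact: nW.
- move=> u i Wu; apply: (@near_eq_derivable _ _ _ f).
    by apply: nW => // w /E.
  exact: smooth_derivable sf Wu.
- move=> i; exists (pderiv i f).
    by exists (pderiv i f) => //; exact: smooth_pderiv.
  move=> u Wu; apply: near_pderiv.
  by apply: nW => // w /E ->.
Qed.

Lemma smooth_differentiable W f u : open W -> csmooth W f -> W u ->
  differentiable f u.
Proof.
move=> oW sf Wu; apply: differentiable_pderiv.
  apply: filterS (open_nbhs_nbhs (conj oW Wu)) => v Wv i.
  exact: smooth_derivable sf Wv.
by move=> i; apply: smooth_continuous Wu; exact: smooth_pderiv.
Qed.

(** Polynomial expressions in the functions of [A]. A derivative of a product is not a product but
    stays polynomial, so this is the class to which coinduction applies. *)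
Inductive generated (A : ('rV[R]_n -> R) -> Prop) : ('rV[R]_n -> R) -> Prop :=
| generated_atom f : A f -> generated A f
| generated_cst c : generated A (cst c)
| generatedD f g : generated A f -> generated A g ->
    generated A (fun u => f u + g u)
| generatedM f g : generated A f -> generated A g ->
    generated A (fun u => f u * g u).

Lemma generated_sum (A : ('rV[R]_n -> R) -> Prop) (I : finType)
  (F : I -> 'rV[R]_n -> R) : (forall i, generated A (F i)) ->
  generated A (fun u => \sum_i F i u).
Proof.
move=> H; elim: (index_enum I) => [|i s IH].
  rewrite (_ : (fun _ => _) = cst 0); first exact: generated_cst.
  by apply/funext => u; rewrite big_nil.
rewrite (_ : (fun _ => _) = (fun u => F i u + \sum_(j <- s) F j u)).
  exact: generatedD.
by apply/funext => u; rewrite big_cons.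
Qed.

(** The sum and product rules propagate stability under derivatives from the atoms to all polynomial
    expressions, so only the atoms need checking. *)
Lemma smooth_generated W (A : ('rV[R]_n -> R) -> Prop) : open W ->
  (forall f, A f -> [/\ forall u, W u -> {for u, continuous f},
     forall u i, W u -> derivable f u (e_ i) &
     forall i, exists2 g, generated A g & forall u, W u -> pderiv i f u = g u]) ->
  forall f, generated A f -> csmooth W f.
Proof.
move=> oW HA; apply: smooth_coind => // f; elim=> {f}
  [f /HA//|c|f g gf [cf df pf] gg [cg dg pg]|f g gf [cf df pf] gg [cg dg pg]].
- split=> [u _|u i _|i]; [exact: cst_continuous|exact: derivable_cst|].
  exists (cst 0); first exact: generated_cst.
  by move=> u _; rewrite pderiv_cst.
- split=> [u Wu|u i Wu|i].
  + by apply: continuousD; [exact: cf|exact: cg].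
  + by apply: derivableD; [exact: df|exact: dg].
  + have [f' gf' Ef] := pf i; have [g' gg' Eg] := pg i.
    exists (fun u => f' u + g' u); first exact: generatedD.
    move=> u Wu; rewrite -Ef // -Eg // !pderivE; apply: deriveD; [exact: df|exact: dg].
- split=> [u Wu|u i Wu|i].
  + by apply: continuousM; [exact: cf|exact: cg].
  + by apply: derivableM; [exact: df|exact: dg].
  + have [f' gf' Ef] := pf i; have [g' gg' Eg] := pg i.
    exists (fun u => f u * g' u + g u * f' u).
      by apply: generatedD; apply: generatedM.
    move=> u Wu; rewrite -Ef // -Eg // !pderivE; apply: deriveM; [exact: df|exact: dg].
Qed.

Lemma generated_smooth W f : open W -> generated (csmooth W) f -> csmooth W f.
Proof.
move=> oW; apply: smooth_generated => // {}f sf.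
split=> [u Wu|u i Wu|i]; [exact: smooth_continuous Wu|exact: smooth_derivable Wu|].
by exists (pderiv i f) => //; apply: generated_atom; exact: smooth_pderiv.
Qed.

Lemma smooth_cst W (c : R) : open W -> csmooth W (cst c).
Proof. by move=> oW; apply: generated_smooth => //; exact: generated_cst. Qed.

Lemma smoothD W f g : open W -> csmooth W f -> csmooth W g ->
  csmooth W (fun u => f u + g u).
Proof.
by move=> oW sf sg; apply: generated_smooth => //; apply: generatedD;
  exact: generated_atom.
Qed.

Lemma smoothM W f g : open W -> csmooth W f -> csmooth W g ->
  csmooth W (fun u => f u * g u).
Proof.
by move=> oW sf sg; apply: generated_smooth => //; apply: generatedM;
  exact: generated_atom.
Qed.

Lemma smoothN W f : open W -> csmooth W f -> csmooth W (fun u => - f u).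
Proof.
move=> oW sf; rewrite (_ : (fun _ => _) = (fun u => cst (-1) u * f u)).
  by apply: smoothM => //; exact: smooth_cst.
by apply/funext => u; rewrite mulN1r.
Qed.

Lemma smoothB W f g : open W -> csmooth W f -> csmooth W g ->
  csmooth W (fun u => f u - g u).
Proof. by move=> oW sf sg; apply: smoothD => //; exact: smoothN. Qed.

Lemma smooth_sum W (I : finType) (F : I -> 'rV[R]_n -> R) : open W ->
  (forall i, csmooth W (F i)) -> csmooth W (fun u => \sum_i F i u).
Proof.
move=> oW H; apply: generated_smooth => //; apply: generated_sum => i.
exact: generated_atom.
Qed.

Lemma smooth_prod W (I : finType) (F : I -> 'rV[R]_n -> R) : open W ->
  (forall i, csmooth W (F i)) -> csmooth W (fun u => \prod_i F i u).
Proof.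
move=> oW H; elim: (index_enum I) => [|i s IH].
  by under eq_fun do rewrite big_nil; exact: smooth_cst.
by under eq_fun do rewrite big_cons; apply: smoothM.
Qed.

Lemma smooth_det W (k : nat) (A : 'rV[R]_n -> 'M[R]_k) : open W ->
  (forall i j, csmooth W (fun u => A u i j)) -> csmooth W (fun u => \det (A u)).
Proof.
move=> oW sA; rewrite /determinant; apply: smooth_sum => // s.
apply: smoothM => //; first exact: smooth_cst.
exact: smooth_prod.
Qed.

Lemma smooth_coord W (j : 'I_n) : open W -> csmooth W (fun u => u 0 j).
Proof.
move=> oW; apply: (@smooth_generated W (fun f => f = (fun u => u 0 j))) => //; last first.
  exact: generated_atom.
move=> _ ->; split=> [u _|u i _|i].
- exact: coord_continuous.
- apply: diff_derivable; exact: differentiable_coord.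
- exists (cst (j == i)%:R); first exact: generated_cst.
  by move=> u _; rewrite pderiv_coord.
Qed.

End smooth_functions.

(** The atoms are the smooth functions on [W] and the pullbacks along [phi] of smooth functions on
    [W']; the chain rule writes a derivative of a pullback as a polynomial in both kinds. *)
Lemma smooth_comp (R : realType) (n m : nat) (W : set 'rV[R]_n)
    (W' : set 'rV[R]_m) (g : 'rV[R]_m -> R) (phi : 'rV[R]_n -> 'rV[R]_m) :
  open W -> open W' -> (forall u, W u -> W' (phi u)) ->
  csmooth W' g ->
  (forall j, csmooth W (fun u => phi u 0 j)) -> csmooth W (g \o phi).
Proof.
move=> oW oW' WW' sg sphi.
have dphi u : W u -> forall j, differentiable (fun w => phi w 0 j) u.
  by move=> Wu j; apply: smooth_differentiable Wu => //; exact: sphi.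
pose A f := csmooth W f \/ exists2 h, csmooth W' h & f = h \o phi.
apply: (@smooth_generated _ _ W A) => //; last first.
  by apply: generated_atom; right; exists g.
move=> f0 [sf|[h sh ->]].
  split=> [u Wu|u i Wu|i].
  - exact: smooth_continuous Wu.
  - exact: smooth_derivable Wu.
  - exists (pderiv i f0) => //; apply: generated_atom; left.
    exact: smooth_pderiv.
have dh u : W u -> differentiable h (phi u).
  by move=> Wu; apply: (smooth_differentiable oW' sh); exact: WW'.
have D u : W u -> differentiable (h \o phi) u.
  by move=> Wu; apply: differentiable_comp; [exact/differentiable_row/dphi|exact: dh].
split=> [u Wu|u i Wu|i].
- exact/differentiable_continuous/D.
- exact/diff_derivable/D.
- exists (fun u => \sum_l pderiv i (fun w => phi w 0 l) u * pderiv l h (phi u)).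
    apply: generated_sum => l; apply: generatedM; apply: generated_atom.
      by left; apply: smooth_pderiv; exact: sphi.
    by right; exists (pderiv l h) => //; exact: smooth_pderiv.
  by move=> u Wu; apply: pderiv_comp; [exact: dh|exact: dphi].
Qed.

(** * Clairaut's theorem *)

Section symmetry_of_second_derivatives.
Context {R : realType} {n : nat}.
Implicit Types (u v : 'rV[R]_n) (f : 'rV[R]_n -> R).

Local Notation e_ i := (delta_mx 0 i : 'rV[R]_n).

Lemma norm_two_steps_le (i j : 'I_n) (a b h : R) : `|a| <= h -> `|b| <= h ->
  `|a *: e_ i + b *: e_ j| <= 2 * h.
Proof.
move=> ah bh; have h0 : 0 <= h by apply: le_trans ah.
have n1 (k : 'I_n) : `|e_ k| <= 1.
  apply: row_norm_le => // l; rewrite mxE eqxx /=.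
  by case: (l == k); rewrite ?normr1 ?normr0.
rewrite mulr_natl mulr2n (le_trans (ler_normD _ _)) // lerD // normrZ.
  by rewrite (le_trans _ ah) // ler_piMr.
by rewrite (le_trans _ bh) // ler_piMr.
Qed.

(** The mean value theorem is applied twice: in direction [i] to the difference of [f] along two
    parallel segments, then in direction [j] to [pderiv i f]. The left-hand side is symmetric in [i]
    and [j], the right-hand side is not visibly so. *)
Lemma second_difference f u (i j : 'I_n) (h : R) : 0 <= h ->
  (forall v, `|v - u| <= 2 * h ->
     derivable f v (e_ i) /\ derivable (pderiv i f) v (e_ j)) ->
  exists2 v, `|v - u| <= 2 * h &
    f (u + h *: e_ i + h *: e_ j) - f (u + h *: e_ i) - f (u + h *: e_ j) + f u
    = h * h * pderiv j (pderiv i f) v.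
Proof.
move=> h0 H.
have hh : `|h| = h by rewrite ger0_norm.
have near2 s t : `|s| <= h -> `|t| <= h -> `|u + t *: e_ j + s *: e_ i - u| <= 2 * h.
  move=> sh th; rewrite addrAC [u + _]addrC addrK addrC.
  exact: norm_two_steps_le.
have hle : `|h| <= h by rewrite hh.
have z0 : `|0 : R| <= h by rewrite normr0.
have d1 t s : `|t| <= h -> `|s| <= h -> is_derive (s : R) 1
    (fun s => f (u + t *: e_ j + s *: e_ i)) (pderiv i f (u + t *: e_ j + s *: e_ i)).
  by move=> th sh; apply: pderiv_line; apply: (H _ _).1; exact: near2.
have d1B s : `|s| <= `|h| -> is_derive (s : R) 1
    ((fun s => f (u + h *: e_ j + s *: e_ i)) - (fun s => f (u + 0 *: e_ j + s *: e_ i)))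
    (pderiv i f (u + h *: e_ j + s *: e_ i) - pderiv i f (u + 0 *: e_ j + s *: e_ i)).
  rewrite hh => sh; apply: is_deriveB; exact: d1.
have [c cle E] := MVT0 d1B.
have ch : `|c| <= h by rewrite -hh.
have d2 t : `|t| <= `|h| -> is_derive (t : R) 1
    (fun t => pderiv i f (u + c *: e_ i + t *: e_ j))
    (pderiv j (pderiv i f) (u + c *: e_ i + t *: e_ j)).
  rewrite hh => th; apply: pderiv_line; apply: (H _ _).2.
  by rewrite (addrAC u); exact: near2.
have [b ble E2] := MVT0 d2.
exists (u + c *: e_ i + b *: e_ j).
  by rewrite (addrAC u); apply: near2 => //; rewrite -hh.
move: E; rewrite !fctE !scale0r !addr0.
rewrite scale0r addr0 in E2; rewrite (addrAC u (h *: e_ j) (c *: e_ i)) E2 => E.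
have -> : h * h * pderiv j (pderiv i f) (u + c *: e_ i + b *: e_ j) =
  pderiv j (pderiv i f) (u + c *: e_ i + b *: e_ j) * h * h by ring.
by rewrite -E (addrAC u (h *: e_ j)); ring.
Qed.

Lemma pderivC (W : set 'rV[R]_n) f u (i j : 'I_n) : open W -> csmooth W f -> W u ->
  pderiv i (pderiv j f) u = pderiv j (pderiv i f) u.
Proof.
move=> oW sf Wu.
have ci k l : {for u, continuous (pderiv k (pderiv l f))}.
  by apply: smooth_continuous Wu; do 2!apply: smooth_pderiv.
apply/eqP; rewrite -subr_eq0 -normr_le0; apply/ler_addgt0Pr => e e0; rewrite add0r.
have e2 : 0 < e / 2 by rewrite divr_gt0.
have Hnear : \forall v \near u, [/\ W v,
    `|pderiv i (pderiv j f) u - pderiv i (pderiv j f) v| <= e / 2 &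
    `|pderiv j (pderiv i f) u - pderiv j (pderiv i f) v| <= e / 2].
  have /cvgrPdist_le/(_ _ e2) A := ci i j.
  have /cvgrPdist_le/(_ _ e2) B := ci j i.
  have C := open_nbhs_nbhs (conj oW Wu).
  apply: filterS (filterI (filterI A B) C) => v.
  by case=> -[a b] d; exact: And3 d a b.
move/nbhs_ballP : Hnear => [r /= r0 rP].
(* The mean value points lie within [2 * h = r / 2] of [u], hence inside the ball of radius [r]. *)
pose h := r / 4.
have h0 : 0 < h by rewrite divr_gt0.
have H v : `|v - u| <= 2 * h -> [/\ W v,
    `|pderiv i (pderiv j f) u - pderiv i (pderiv j f) v| <= e / 2 &
    `|pderiv j (pderiv i f) u - pderiv j (pderiv i f) v| <= e / 2].
  move=> vu; apply: rP; rewrite -ball_normE /= distrC (le_lt_trans vu) // /h.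
  by lra.
have [v /H[_ _ v2] Ev] : exists2 v, `|v - u| <= 2 * h &
    f (u + h *: e_ i + h *: e_ j) - f (u + h *: e_ i) - f (u + h *: e_ j) + f u
    = h * h * pderiv j (pderiv i f) v.
  apply: second_difference; first exact: ltW.
  move=> v /H[Wv _ _]; split; first exact: smooth_derivable Wv.
  by apply: smooth_derivable Wv; exact: smooth_pderiv.
have [w /H[_ w1 _] Ew] : exists2 v, `|v - u| <= 2 * h &
    f (u + h *: e_ j + h *: e_ i) - f (u + h *: e_ j) - f (u + h *: e_ i) + f u
    = h * h * pderiv i (pderiv j f) v.
  apply: second_difference; first exact: ltW.
  move=> w /H[Ww _ _]; split; first exact: smooth_derivable Ww.
  by apply: smooth_derivable Ww; exact: smooth_pderiv.
(* Both mixed derivatives, at possibly different points near [u], are the same second difference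
   divided by [h * h]. *)
have E : pderiv i (pderiv j f) w = pderiv j (pderiv i f) v.
  have hn : h * h != 0 by rewrite mulf_neq0 // gt_eqF.
  apply: (mulfI hn); apply: etrans (esym Ew) _; apply: etrans Ev.
  by rewrite (addrAC u (h *: e_ j)); ring.
rewrite -(subrKA (pderiv i (pderiv j f) w)).
apply: le_trans (ler_normD _ _) _; rewrite [e]splitr; apply: lerD w1 _.
by rewrite E distrC; exact: v2.
Qed.

End symmetry_of_second_derivatives.

(** * The Poincare lemma for 3-forms *)

Section radial_integrals.
Context {R : realType} {n : nat} (c : 'rV[R]_n) (r : R).
Implicit Types (u v : 'rV[R]_n) (f h : 'rV[R]_n -> R) (k : nat).

Local Notation e_ i := (delta_mx 0 i : 'rV[R]_n).
Local Notation mu := (@lebesgue_measure R).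
Local Notation O := (ball c r).

Lemma ball_rowE (a : 'rV[R]_n) (s : R) v : ball a s v = (`|v - a| < s) :> Prop.
Proof. by rewrite -ball_normE /= distrC. Qed.

Lemma open_ball_row (a : 'rV[R]_n) (s : R) : open (ball a s).
Proof. exact: ball_open. Qed.

Lemma ray_sub (t : R) u : c + t *: (u - c) - c = t *: (u - c).
Proof. by rewrite addrAC subrr add0r. Qed.

Lemma ray_le (t : R) u : t \in `[0, 1] -> `|c + t *: (u - c) - c| <= `|u - c|.
Proof.
rewrite in_itv /= => /andP[t0 t1]; rewrite ray_sub normrZ ger0_norm //.
by rewrite ler_piMl.
Qed.

Lemma ray_ball (t : R) u : t \in `[0, 1] -> O u -> O (c + t *: (u - c)).
Proof. by move=> t01; rewrite !ball_rowE; apply: le_lt_trans; exact: ray_le. Qed.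

(** Closed balls of R^n are compact. The bound is the dominating constant for differentiation under
    the integral sign. *)
Lemma smooth_bounded h (rho : R) : csmooth O h -> 0 <= rho -> rho < r ->
  exists2 M, 0 <= M & forall v, `|v - c| <= rho -> `|h v| <= M.
Proof.
move=> sh rho0 rhor; pose A : set 'rV[R]_n := [set v | `|v - c| <= rho].
have AO : A `<=` O by move=> v; rewrite ball_rowE /A /= => vr; exact: le_lt_trans rhor.
have cA : compact A.
  apply: bounded_closed_compact.
    exists (rho + `|c|); split; first exact: num_real.
    move=> M ltM v /= vA; apply: le_trans (ltW ltM).
    by rewrite -{1}(subrK c v) (le_trans (ler_normD _ _)) // lerD2r.
  rewrite (_ : A = closed_ball_ Num.norm c rho); first exact: closed_closed_ball_.
  by apply/seteqP; split => v /=; rewrite /closed_ball_ /A /= distrC.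
have [||v0 _ H] := @EVT_max_rV R n (fun v => `|h v|) A _ cA.
- by exists c; rewrite /A /= subrr normr0.
- apply: continuous_in_subspaceT => v; rewrite inE => /AO Ov.
  apply: (@continuous_comp _ _ _ h) => //; last exact: norm_continuous.
  exact: smooth_continuous Ov.
- exists `|h v0| => // v vr; apply: H; exact/mem_set.
Qed.

(** The weight [t ^+ k] is kept general because differentiating in [u] brings out a factor [t]. The
    case [k = 2] is the weight of the cone operator on 3-forms. *)
Definition radial k h u : R :=
  (\int[mu]_(t in `[0%R, 1%R]) (t ^+ k * h (c + t *: (u - c))))%R.

Lemma is_derive_ray h u (t : R) : csmooth O h -> O (c + t *: (u - c)) ->
  is_derive t 1 (fun s => h (c + s *: (u - c)))
    (\sum_i (u - c) 0 i * pderiv i h (c + t *: (u - c))).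
Proof.
move=> sh Ot; have dh := smooth_differentiable (@open_ball_row c r) sh Ot.
rewrite -derive_pderiv //; apply: is_derive_line; exact: diff_derivable.
Qed.

Lemma radial_integrand_continuous k h u (t : R) : csmooth O h -> O u -> t \in `[0, 1] ->
  {for t, continuous (fun t : R => t ^+ k * h (c + t *: (u - c)))}.
Proof.
move=> sh Ou t01; apply: continuousM; first exact: exprn_continuous.
have [d _] := is_derive_ray sh (ray_ball t01 Ou).
exact/differentiable_continuous/derivable1_diffP.
Qed.

Lemma radial_integrable k h u : csmooth O h -> O u ->
  mu.-integrable `[0, 1] (EFin \o (fun t : R => t ^+ k * h (c + t *: (u - c)))).
Proof.
move=> sh Ou; apply: continuous_compact_integrable; first exact: segment_compact.
apply: continuous_in_subspaceT => t; rewrite inE /= => t01.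
exact: radial_integrand_continuous.
Qed.

Lemma norm_radial_le k h u (M : R) : csmooth O h -> O u -> 0 <= M ->
  (forall v, `|v - c| <= `|u - c| -> `|h v| <= M) -> `|radial k h u| <= M.
Proof.
move=> sh Ou M0 HM; have ih := radial_integrable k sh Ou.
apply: le_trans (le_normr_Rintegral _ ih) _ => //.
have E : \int[mu]_(t in `[0%R, 1%R]) (cst M t) = M.
  rewrite Rintegral_cst //= lebesgue_measure_itv /= lte01 //.
  by rewrite oppr0 addr0 /= mulr1.
rewrite -{}E; apply: le_Rintegral => //.
- exact: integrable_norm.
- apply: continuous_compact_integrable; first exact: segment_compact.
  by apply: continuous_subspaceT => ?; exact: cst_continuous.
- move=> t t01; rewrite normrM -[leRHS]mul1r ler_pM //.
  + move: t01; rewrite /= in_itv /= => /andP[t0 t1].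
    by rewrite normrX ger0_norm // exprn_ile1.
  + exact/HM/ray_le.
Qed.

(** Differentiation under the integral sign: moving [u] by [s] along a coordinate moves the point at
    time [t] of the ray by [s * t], which accounts for the extra power of [t]. *)
Lemma is_derive_radial k h u i : csmooth O h -> O u ->
  derivable (radial k h) u (e_ i) /\
  pderiv i (radial k h) u = radial k.+1 (pderiv i h) u.
Proof.
(* [rho] lies halfway between the distance from [u] to the centre and [r], and [d] below is the gap,
   so that a step shorter than [d] from [u] stays in the closed ball of radius [rho]. *)
move=> sh Ou; pose rho := (`|u - c| + r) / 2.
have ur : `|u - c| < r by rewrite -ball_rowE.
have u0 := normr_ge0 (u - c).
have rho0 : 0 <= rho by rewrite /rho; lra.
have rhor : rho < r by rewrite /rho; lra.
have [M M0 HM] := smooth_bounded (smooth_pderiv i sh) rho0 rhor.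
pose d := (r - `|u - c|) / 2.
have d0 : 0 < d by rewrite /d; lra.
have sr (s : R) : s \in `](- d), d[ -> `|u + s *: e_ i - c| <= rho.
  rewrite in_itv /= -ltr_norml => sd; rewrite addrAC.
  apply: le_trans (ler_normD _ _) _.
  have : `|s *: e_ i| <= d.
    apply: row_norm_le => [|j]; first exact: ltW.
    rewrite !mxE eqxx /=; case: (j == i); rewrite ?mulr1 ?mulr0 ?normr0 ltW //.
  rewrite /rho /d; lra.
have sO s : s \in `](- d), d[ -> O (u + s *: e_ i).
  by move=> /sr H; rewrite ball_rowE; exact: le_lt_trans rhor.
pose F (s t : R) : R := t ^+ k * h (c + t *: (u + s *: e_ i - c)).
have dF s t : s \in `](- d), d[ -> t \in `[0, 1] -> is_derive s 1 (F ^~ t)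
    (t ^+ k.+1 * pderiv i h (c + t *: (u + s *: e_ i - c))).
  move=> sd t01; have Ot := ray_ball t01 (sO s sd).
  have E s' : c + t *: (u + s' *: e_ i - c) = c + t *: (u - c) + s' *: (t *: e_ i).
    by rewrite addrAC scalerDr addrA !scalerA [t * s']mulrC.
  have dh := smooth_differentiable (@open_ball_row c r) sh Ot.
  rewrite exprSr -mulrA.
  have -> : F ^~ t = (t ^+ k) *: (fun s => h (c + t *: (u - c) + s *: (t *: e_ i))).
    by apply/funext => s'; rewrite /F E.
  apply: is_deriveZ.
  have -> : t * pderiv i h (c + t *: (u + s *: e_ i - c)) =
      'D_(t *: e_ i) h (c + t *: (u + s *: e_ i - c)).
    rewrite derive_pderiv // (bigD1 i) //= big1 => [|j ji].
      by rewrite !mxE !eqxx mulr1 addr0.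
    by rewrite !mxE eqxx (negbTE ji) mulr0 mul0r.
  rewrite E; apply: is_derive_line; rewrite -E; exact: diff_derivable.
have d00 : (0 : R) \in `](- d), d[ by rewrite in_itv /= oppr_lt0 d0.
have d00' : `](- d), d[%classic (0 : R) by [].
have Dval s t (sd : s \in `](- d), d[) (t01 : t \in `[0, 1]) :=
  @derive_val _ _ _ _ _ _ _ (dF s t sd t01).
have intF s : `](- d), d[%classic s -> mu.-integrable `[0, 1] (EFin \o F s).
  by move=> sd; apply: radial_integrable => //; exact: sO.
have intM : mu.-integrable `[0, 1] (EFin \o cst M).
  apply: continuous_compact_integrable; first exact: segment_compact.
  by apply: continuous_subspaceT => ?; exact: cst_continuous.
have derF s t : `](- d), d[%classic s -> `[0, 1]%classic t -> derivable (F ^~ t) s 1.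
  by move=> sd t01; have [] := dF s t sd t01.
have bndF s t : `](- d), d[%classic s -> `[0, 1]%classic t ->
    `|partial1of2 F s t| <= cst M t.
  move=> sd t01; rewrite partial1of2E (Dval s t sd t01) normrM -[leRHS]mul1r ler_pM //.
    move: t01; rewrite /= in_itv /= => /andP[t0 t1].
    by rewrite normrX ger0_norm // exprn_ile1.
  by apply: HM; rewrite (le_trans (ray_le _ t01)) // sr.
have EF : (fun s : R => radial k h (u + s *: e_ i)) =
    (fun s => \int[mu]_(t in `[0%R, 1%R]) F s t) by [].
have m01 : measurable (`[0%R, 1%R]%classic : set (measurableTypeR R)) by [].
have D := @derivable_under_integral R _ _ mu F _ m01 0 (- d) d d00'
  intF derF (cst M) (fun=> M0) intM bndF.
have E := @differentiation_under_integral R _ _ mu F _ m01 0 (- d) d d00'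
  intF derF (cst M) (fun=> M0) intM bndF.
move: D E; rewrite -EF derive1E derivable_line derive_line scale0r addr0 => D E.
split => //; rewrite pderivE E; apply: eq_Rintegral => t; rewrite inE => t01.
by rewrite partial1of2E (Dval 0 t d00 t01) scale0r addr0.
Qed.

(** The partial derivatives of the integral exist and are bounded near [u] by [is_derive_radial], so
    the integral is Lipschitz there. *)
Lemma radial_continuous k h u : csmooth O h -> O u -> {for u, continuous (radial k h)}.
Proof.
move=> sh Ou; pose rho := (`|u - c| + r) / 2.
have ur : `|u - c| < r by rewrite -ball_rowE.
have u0 := normr_ge0 (u - c).
have rho0 : 0 <= rho by rewrite /rho; lra.
have rhor : rho < r by rewrite /rho; lra.
have [M M0 HM] : exists2 M, 0 <= M &
    forall i v, `|v - c| <= rho -> `|pderiv i h v| <= M.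
  (* One bound is chosen per coordinate; their sum serves all coordinates at once. *)
  have := fun i => cid2 (smooth_bounded (smooth_pderiv i sh) rho0 rhor).
  move=> b; exists (\sum_i s2val (b i)).
    by apply: sumr_ge0 => i _; exact: s2valP (b i).
  move=> i v vr; apply: le_trans (s2valP' (b i) v vr) _.
  rewrite (bigD1 i) //= lerDl; apply: sumr_ge0 => j _; exact: s2valP (b j).
pose d := (r - `|u - c|) / 2.
have d0 : 0 < d by rewrite /d; lra.
apply: continuous_dist_le => e e0.
(* The summand 1 keeps the divisor positive when [n] or [M] is zero. *)
have nM : 0 < n%:R * M + 1 by rewrite ltr_wpDl // mulr_ge0.
have m0 : 0 < Num.min d (e / (n%:R * M + 1)) by rewrite lt_min d0 divr_gt0.
apply/nbhs_ballP; exists (Num.min d (e / (n%:R * M + 1))) => // v.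
rewrite ball_rowE lt_min => /andP[vd ve].
rewrite distrC -[v](subrK u) (addrC (v - u)).
have rhow w : `|w - u| <= `|v - u| -> `|w - c| <= rho.
  move=> wv; rewrite -(subrKA u) (le_trans (ler_normD _ _)) //.
  by have := le_lt_trans wv vd; rewrite /rho /d; lra.
have L w : `|w - u| <= `|v - u| -> forall i,
    derivable (radial k h) w (e_ i) /\ `|pderiv i (radial k h) w - 0| <= M.
  move=> /rhow wr i; have Ow : O w by rewrite ball_rowE; exact: le_lt_trans rhor.
  have [D E] := is_derive_radial k i sh Ow; split => //.
  rewrite subr0 E; apply: norm_radial_le => //; first exact: smooth_pderiv.
  by move=> x xw; apply: HM; exact: le_trans wr.
have := increment_le M0 L.
rewrite big1 => [|i _]; last by rewrite mulr0.
rewrite subr0 => /le_trans; apply.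
rewrite (@le_trans _ _ ((n%:R * M + 1) * `|v - u|)) //.
  by rewrite ler_wpM2r // lerDl.
by rewrite mulrC -ler_pdivlMr // ltW.
Qed.

(** Coinduction on the class of all [radial k h] with [k] and [h] varying. *)
Lemma smooth_radial k h : csmooth O h -> csmooth O (radial k h).
Proof.
move=> sh; apply: (@smooth_coind R n O (fun f => exists2 k, True &
  exists2 h, csmooth O h & f = radial k h)); first exact: open_ball_row.
  move=> {k sh}_ {h}[k _ [h sh ->]]; split=> [u Ou|u i Ou|i].
  - exact: radial_continuous.
  - exact: (is_derive_radial k i sh Ou).1.
  - exists (radial k.+1 (pderiv i h)).
      by exists k.+1 => //; exists (pderiv i h) => //; exact: smooth_pderiv.
    by move=> u Ou; exact: (is_derive_radial k i sh Ou).2.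
by exists k => //; exists h.
Qed.

Lemma eq_radial k f h u : O u -> (forall v, O v -> f v = h v) ->
  radial k f u = radial k h u.
Proof.
move=> Ou fh; apply: eq_Rintegral => t; rewrite inE => t01.
by rewrite fh //; exact: ray_ball.
Qed.

Lemma radialD k f h u : O u -> csmooth O f -> csmooth O h ->
  radial k (fun v => f v + h v) u = radial k f u + radial k h u.
Proof.
move=> Ou sf sh; rewrite /radial -RintegralD //.
- by apply: eq_Rintegral => t _; rewrite mulrDr.
- exact: radial_integrable.
- exact: radial_integrable.
Qed.

Lemma radialZ k (a : R) h u : O u -> csmooth O h ->
  radial k (fun v => a * h v) u = a * radial k h u.
Proof.
move=> Ou sh; rewrite /radial -RintegralZl //.
- by apply: eq_Rintegral => t _; rewrite mulrCA.
- exact: radial_integrable.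
Qed.

Lemma radialN k h u : O u -> csmooth O h ->
  radial k (fun v => - h v) u = - radial k h u.
Proof.
move=> Ou sh; rewrite -mulN1r -radialZ //.
by apply: eq_radial => // v _; rewrite mulN1r.
Qed.

Lemma radial_sum k (a : 'I_n -> R) (f : 'I_n -> 'rV[R]_n -> R) u : O u ->
  (forall i, csmooth O (f i)) ->
  radial k (fun v => \sum_i a i * f i v) u = \sum_i a i * radial k (f i) u.
Proof.
move=> Ou sf; have oO := @open_ball_row c r.
have saf i : csmooth O (fun v => a i * f i v).
  by apply: smoothM => //; exact: smooth_cst.
suff [] : csmooth O (fun v => \sum_i a i * f i v) /\
  radial k (fun v => \sum_i a i * f i v) u = \sum_i a i * radial k (f i) u by [].
elim: (index_enum _) => [|i s [sS IH]].
  under eq_fun do rewrite big_nil.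
  split; first exact: smooth_cst.
  rewrite big_nil -[RHS](mul0r (radial k (cst 0) u)) -radialZ //; last exact: smooth_cst.
  by apply: eq_radial => // v _; rewrite mulr0.
under eq_fun do rewrite big_cons.
split; first exact: smoothD.
by rewrite radialD // radialZ // IH big_cons.
Qed.

(** The fundamental theorem of calculus for [t ^+ k.+1 * h (c + t *: (u - c))] on [0, 1]; the
    boundary term at 0 vanishes because the exponent is positive. This is the identity behind the
    homotopy formula of the cone operator. *)
Lemma radial_FTC k h u : csmooth O h -> O u ->
  h u = k.+1%:R * radial k h u + \sum_i (u - c) 0 i * radial k.+1 (pderiv i h) u.
Proof.
move=> sh Ou; have oO := @open_ball_row c r.
have sp i := smooth_pderiv i sh.
pose g v := \sum_i (u - c) 0 i * pderiv i h v.
have sg : csmooth O g.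
  by apply: smooth_sum => // i; apply: smoothM => //; exact: smooth_cst.
pose F (t : R) : R := t ^+ k.+1 * h (c + t *: (u - c)).
pose f1 (t : R) : R := k.+1%:R * (t ^+ k * h (c + t *: (u - c))).
pose f2 (t : R) : R := t ^+ k.+1 * g (c + t *: (u - c)).
have dF t : t \in `[0, 1] -> is_derive (t : R) 1 F ((f2 \+ f1) t).
  move=> t01; have D := is_derive_ray sh (ray_ball t01 Ou).
  have -> : (f2 \+ f1) t = t ^+ k.+1 *: g (c + t *: (u - c)) +
      h (c + t *: (u - c)) *: (k.+1%:R * t ^+ k : R).
    rewrite /f1 /f2 /=; congr (_ + _); rewrite mulrA mulrC //.
  apply: is_deriveM
; split; first exact: exprn_derivable.
  by rewrite exp_derive [_ *: 1]mulr1.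
have cF t : t \in `[0, 1] -> {for t, continuous F}.
  by move=> /dF[d _]; exact/differentiable_continuous/derivable1_diffP.
have i1 : mu.-integrable `[0, 1] (EFin \o (fun t : R => t ^+ k * h (c + t *: (u - c)))).
  exact: radial_integrable.
have i2 : mu.-integrable `[0, 1] (EFin \o f2) by exact: radial_integrable.
have cf1 : {within `[0, 1], continuous (f2 \+ f1)}.
  apply: continuous_in_subspaceT => t; rewrite inE /= => t01.
  apply: continuousD; first exact: radial_integrand_continuous.
  apply: continuousM; first exact: cst_continuous.
  exact: radial_integrand_continuous.
have I : (\int[mu]_(t in `[0%R, 1%R]) (f2 \+ f1) t = h u)%R.
  rewrite /Rintegral (@continuous_FTC2 _ (f2 \+ f1) F) //.
  - rewrite /F expr1n mul1r scale1r expr0n mul0r sube0 /=.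
    by rewrite addrC subrK.
  - split.
    + by move=> t t01; have [] := dF t (subset_itv_oo_cc t01).
    + by apply: cvg_at_right_filter; apply: cF; rewrite in_itv /= lexx ler01.
    + by apply: cvg_at_left_filter; apply: cF; rewrite in_itv /= lexx ler01.
  - move=> t t01; rewrite derive1E; have D := dF t (subset_itv_oo_cc t01).
    exact: derive_val.
have i3 : mu.-integrable `[0, 1] (EFin \o f1).
  rewrite (_ : EFin \o f1 = fun t => (k.+1%:R%:E *
    (EFin \o (fun t : R => (t ^+ k * h (c + t *: (u - c)))%R)) t)%E).
    exact: integrableZl.
  by apply/funext => t; rewrite /f1 /= EFinM.
rewrite -{1}I RintegralD //.
rewrite addrC; congr (_ + _).
  by rewrite RintegralZl.
by rewrite -radial_sum.
Qed.

End radial_integrals.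

(* The primitive is given by the cone operator with apex [c]:
   [B j k u = \sum_l (u - c)_l int_0^1 t^2 H l j k (c + t (u - c)) dt]. *)
Lemma poincare3 (R : realType) (n : nat) (c : 'rV[R]_n) (r : R)
    (H : 'I_n -> 'I_n -> 'I_n -> 'rV[R]_n -> R) :
  (forall i j k, csmooth (ball c r) (H i j k)) ->
  (forall u, ball c r u -> forall i j k,
     H i j k u = - H j i k u /\ H i j k u = - H i k j u) ->
  (forall u, ball c r u -> forall i j k l,
     pderiv i (H j k l) u - pderiv j (H i k l) u
     + pderiv k (H i j l) u - pderiv l (H i j k) u = 0) ->
  exists B : 'I_n -> 'I_n -> 'rV[R]_n -> R,
  [/\ forall i j, csmooth (ball c r) (B i j),
      forall u, ball c r u -> forall i j, B i j u = - B j i u,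
      forall i j, B i j c = 0 &
      forall u, ball c r u -> forall i j k,
        pderiv i (B j k) u - pderiv j (B i k) u + pderiv k (B i j) u
        = H i j k u].
Proof.
move=> sH aH cH; have oO := @open_ball_row R n c r.
pose B j k u := \sum_l (u - c) 0 l * radial c 2 (H l j k) u.
have s1 l : csmooth (ball c r) (fun u => (u - c) 0 l).
  apply: (@smooth_eq _ _ _ (fun u => u 0 l - cst (c 0 l) u)) => //.
    by move=> u _; rewrite !mxE.
  apply: smoothB => //; [exact: smooth_coord|exact: smooth_cst].
have sB j k : csmooth (ball c r) (B j k).
  apply: smooth_sum => // l; apply: smoothM => //; exact: smooth_radial.
(* Product rule: differentiating the factor [(u - c) 0 l] leaves only the term [l = i],
   differentiating the integral raises its weight. *)
have pB u i j k : ball c r u -> pderiv i (B j k) u =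
    radial c 2 (H i j k) u + \sum_l (u - c) 0 l * radial c 3 (pderiv i (H l j k)) u.
  move=> Ou.
  have d l : derivable (fun u : 'rV[R]_n => (u - c) 0 l) u (delta_mx 0 i).
    exact: smooth_derivable Ou.
  have dr l := is_derive_radial 2 i (sH l j k) Ou.
  rewrite pderiv_sumM // => [|l]; last exact: (dr l).1.
  rewrite big_split /= addrC; congr (_ + _); last first.
    by apply: eq_bigr => l _; rewrite (dr l).2.
  have E l : pderiv i (fun u : 'rV[R]_n => (u - c) 0 l) u = (l == i)%:R.
    rewrite (_ : (fun u : 'rV[R]_n => _) =
      (fun u : 'rV[R]_n => u 0 l + cst (- c 0 l) u)); last first.
      by apply/funext => w; rewrite !mxE.
    rewrite pderivD; [|exact: derivable_coord|exact: derivable_cst].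
    by rewrite pderiv_coord pderiv_cst addr0.
  rewrite (bigD1 i) //= big1 => [|l li]; rewrite E.
    by rewrite eqxx mulr1 addr0.
  by rewrite (negbTE li) mulr0.
exists B; split => //.
- move=> u Ou i j; rewrite /B -sumrN; apply: eq_bigr => l _.
  rewrite -mulrN -(@radialN _ _ c r) //; congr (_ * _).
  by apply: (@eq_radial _ _ c r) => // v Ov; exact: (aH v Ov l i j).2.
- by move=> i j; rewrite /B subrr big1 // => l _; rewrite mxE mul0r.
- move=> u Ou i j k; rewrite !pB //.
  (* With weight 2 the coefficient is 3. By antisymmetry the three integrals outside the sums in dB
     are all equal to that of [H i j k], which matches this 3. *)
  rewrite (radial_FTC 2 (sH i j k) Ou).
  have -> : radial c 2 (H j i k) u = - radial c 2 (H i j k) u.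
    rewrite -(@radialN _ _ c r) //.
    by apply: (@eq_radial _ _ c r) => // v Ov; exact: (aH v Ov j i k).1.
  have -> : radial c 2 (H k i j) u = radial c 2 (H i j k) u.
    apply: (@eq_radial _ _ c r) => // v Ov.
    by rewrite (aH v Ov i j k).2 -(aH v Ov k i j).1.
  (* Closedness of H trades the derivative in direction [l] for those in directions [i], [j], [k],
     which are the sums occurring in dB. *)
  have -> : \sum_l (u - c) 0 l * radial c 3 (pderiv l (H i j k)) u =
     \sum_l (u - c) 0 l * radial c 3 (pderiv i (H l j k)) u
     - \sum_l (u - c) 0 l * radial c 3 (pderiv j (H l i k)) u
     + \sum_l (u - c) 0 l * radial c 3 (pderiv k (H l i j)) u.
    rewrite -sumrB -big_split /=; apply: eq_bigr => l _.
    rewrite -mulrBr -mulrDr; congr (_ * _).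
    have sp a x y z : csmooth (ball c r) (pderiv a (H x y z)) by exact: smooth_pderiv.
    rewrite -(@radialN _ _ c r) // -!(@radialD _ _ c r) //.
    + apply: (@eq_radial _ _ c r) => // v Ov.
      have nO (f g : 'rV[R]_n -> R) a : (forall w, ball c r w -> f w = g w) ->
        pderiv a f v = pderiv a g v.
        move=> fg; apply: near_pderiv.
        exact: filterS (open_nbhs_nbhs (conj oO Ov)).
      have -> : pderiv i (H l j k) v = pderiv i (H j k l) v.
        apply: nO => w Ow.
        by rewrite (aH w Ow l j k).1 (aH w Ow j l k).2 opprK.
      have -> : pderiv j (H l i k) v = pderiv j (H i k l) v.
        apply: nO => w Ow.
        by rewrite (aH w Ow l i k).1 (aH w Ow i l k).2 opprK.
      have -> : pderiv k (H l i j) v = pderiv k (H i j l) v.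
        apply: nO => w Ow.
        by rewrite (aH w Ow l i j).1 (aH w Ow i l j).2 opprK.
      by apply/eqP; rewrite eq_sym -subr_eq0 cH.
    + by apply: smoothD => //; exact: smoothN.
    + exact: smoothN.
  ring.
Qed.

(** * Charts and generalized tangent vectors *)

Section chart_lemmas.
Context {R : realType} {n : nat} {X : topologicalType} (ch : chart R n X).

Lemma crd_nbhs p : dom ch p -> {for p, continuous (crd ch)}.
Proof.
move=> dp; have := @crd_continuous _ _ _ ch.
by rewrite (continuous_open_subspace _ (@open_dom _ _ _ ch)) => /(_ p (mem_set dp)).
Qed.

Lemma par_nbhs u : (crd ch @` dom ch) u -> {for u, continuous (par ch)}.
Proof.
move=> du; have := @par_continuous _ _ _ ch.
by rewrite (continuous_open_subspace _ (@open_img _ _ _ ch)) => /(_ u (mem_set du)).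
Qed.

Lemma open_crd (V : set X) : open V -> open (crd ch @` (dom ch `&` V)).
Proof.
move=> oV; rewrite openE => _ [p [dp Vp] <-].
have ip : (crd ch @` dom ch) (crd ch p) by exists p.
have cp := par_nbhs ip.
have nV : nbhs (par ch (crd ch p)) V by rewrite crdK //; exact: open_nbhs_nbhs.
have npV : nbhs (crd ch p) (par ch @^-1` V) := cp _ nV.
have ni := open_nbhs_nbhs (conj (@open_img _ _ _ ch) ip).
apply: (@filterS _ _ (nbhs_filter (crd ch p)) _ _ _ (filterI npV ni)) => w [Vw [q dq qw]].
by exists q => //; split => //; move: Vw; rewrite /= -qw crdK.
Qed.

End chart_lemmas.

Section transition_maps.
Context {R : realType} {n : nat} {X : manifold R n}.
Implicit Types (a b c : idx X) (p q : X).

Local Notation dom_ a := (dom (atlas a)).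
Local Notation crd_ a := (crd (atlas a)).
Local Notation par_ a := (par (atlas a)).

Definition trans a b : 'rV[R]_n -> 'rV[R]_n := crd_ b \o par_ a.

Lemma transE a b p : dom_ a p -> trans a b (crd_ a p) = crd_ b p.
Proof. by move=> ap; rewrite /trans /= crdK. Qed.

Lemma open_overlap a b : open (crd_ a @` (dom_ a `&` dom_ b)).
Proof. exact/open_crd/open_dom. Qed.

Lemma trans_csmooth a b j :
  csmooth (crd_ a @` (dom_ a `&` dom_ b)) (fun u => trans a b u 0 j).
Proof. by have /smooth_mapE := @atlas_smooth _ _ X a b; exact. Qed.

Lemma trans_differentiable a b p j : dom_ a p -> dom_ b p ->
  differentiable (fun u => trans a b u 0 j) (crd_ a p).
Proof.
move=> ap bp; apply: smooth_differentiable (trans_csmooth a b j) _.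
  exact: open_overlap.
by exists p.
Qed.

Lemma transition_jacE a b p : dom_ a p -> dom_ b p ->
  transition_jac a b p =
  \matrix_(i, j) pderiv i (fun u => trans a b u 0 j) (crd_ a p).
Proof. by move=> ap bp; apply: jacobianE => j; exact: trans_differentiable. Qed.

(** Transformation laws hold at the points of an overlap of charts; this puts them on a
    neighbourhood in coordinates, so that they can be differentiated. *)
Lemma near_crd a p (A : 'rV[R]_n -> Prop) (V : set X) : open V -> V p ->
  dom_ a p -> (forall q, dom_ a q -> V q -> A (crd_ a q)) ->
  \forall u \near crd_ a p, A u.
Proof.
move=> oV Vp ap H.
have := open_nbhs_nbhs (conj (@open_crd _ _ _ (atlas a) V oV)
  (ex_intro2 _ _ p (conj ap Vp) erefl)).
by apply: filterS => _ [q [aq Vq] <-]; exact: H.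
Qed.

Lemma jac_id a p : dom_ a p -> transition_jac a a p = 1%:M.
Proof.
move=> ap; rewrite transition_jacE //; apply/matrixP => i j; rewrite !mxE.
rewrite (@near_pderiv _ _ _ (fun u => u 0 j)) ?pderiv_coord 1?eq_sym //.
by apply: near_crd openT _ ap _ => // q aq _; rewrite transE.
Qed.

Lemma jac_comp a b c p : dom_ a p -> dom_ b p -> dom_ c p ->
  transition_jac a b p *m transition_jac b c p = transition_jac a c p.
Proof.
move=> ap bp cp; rewrite !transition_jacE //; apply/matrixP => i j; rewrite !mxE.
rewrite [RHS](@near_pderiv _ _ _ ((fun u => trans b c u 0 j) \o trans a b)).
  rewrite pderiv_comp => [||k].
  - by apply: eq_bigr => l _; rewrite !mxE transE.
  - by rewrite transE //; exact: trans_differentiable.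
  - exact: trans_differentiable.
apply: near_crd (@open_dom _ _ _ (atlas b)) bp ap _ => q aq bq /=.
by rewrite !transE.
Qed.

Lemma jacV a b p : dom_ a p -> dom_ b p ->
  transition_jac a b p *m transition_jac b a p = 1%:M.
Proof. by move=> ap bp; rewrite jac_comp // jac_id. Qed.

End transition_maps.

Section generalized_tangent_vectors.
Context {R : realType} {n : nat} {X : manifold R n}.
Implicit Types (a b c : idx X) (p q : X) (e f : gvec X).

Local Notation dom_ a := (dom (atlas a)).
Local Notation crd_ a := (crd (atlas a)).
Local Notation vec := ('rV[R]_n * 'rV[R]_n)%type.

Definition chart_comp a e : vec := (e.1 a, e.2 a).

Definition dot (x y : 'rV[R]_n) : R := (x *m y^T) 0 0.

Definition vpair (w z : vec) : R := dot z.2 w.1 + dot w.2 z.1.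

Lemma dotE x y : dot x y = \sum_i x 0 i * y 0 i.
Proof. by rewrite /dot mxE; apply: eq_bigr => i _; rewrite mxE. Qed.

Lemma dotC x y : dot x y = dot y x.
Proof. by rewrite !dotE; apply: eq_bigr => i _; rewrite mulrC. Qed.

Lemma dot_mulmx x y (M : 'M[R]_n) : dot (x *m M) y = dot x (y *m M^T).
Proof. by rewrite /dot trmx_mul trmxK mulmxA. Qed.

Lemma dotDl x y z : dot (x + y) z = dot x z + dot y z.
Proof. by rewrite /dot mulmxDl mxE. Qed.

Lemma dotDr x y z : dot z (x + y) = dot z x + dot z y.
Proof. by rewrite dotC dotDl !(dotC z). Qed.

Lemma dotZl (k : R) x z : dot (k *: x) z = k * dot x z.
Proof. by rewrite /dot -scalemxAl mxE. Qed.

Lemma dotZr (k : R) x z : dot z (k *: x) = k * dot z x.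
Proof. by rewrite dotC dotZl dotC. Qed.

Lemma pairingE a e f : pairing a e f = vpair (chart_comp a e) (chart_comp a f).
Proof. by rewrite /pairing /vpair !dotE. Qed.

Lemma vpairC w z : vpair w z = vpair z w.
Proof. by rewrite /vpair addrC. Qed.

Lemma vpairDl w1 w2 z : vpair (w1 + w2) z = vpair w1 z + vpair w2 z.
Proof. by rewrite /vpair dotDr dotDl; ring. Qed.

Lemma vpairZl (k : R) w z : vpair (k *: w) z = k * vpair w z.
Proof. by rewrite /vpair dotZr dotZl; ring. Qed.

Lemma vpair_suml (I : finType) (k : I -> R) (w : I -> vec) z :
  vpair (\sum_i k i *: w i) z = \sum_i k i * vpair (w i) z.
Proof.
elim: (index_enum I) => [|i s IH].
  rewrite !big_nil /vpair /dot /= trmx0 mulmx0 mul0mx mxE; ring.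
by rewrite !big_cons vpairDl vpairZl IH.
Qed.

Lemma gtangent_chart p e a b : gtangent p e -> dom_ a p -> dom_ b p ->
  e.1 b = e.1 a *m transition_jac a b p /\
  e.2 b = e.2 a *m (transition_jac b a p)^T.
Proof. by case=> -[_ H1] [_ H2] ap bp; split; [exact: H1|exact: H2]. Qed.

(** Vectors and covectors transform contragrediently, so a Jacobian meets its inverse in each
    summand. *)
Lemma pairing_chart p e f a b : gtangent p e -> gtangent p f ->
  dom_ a p -> dom_ b p -> pairing b e f = pairing a e f.
Proof.
move=> te tf ap bp; rewrite !pairingE /vpair /=.
have [-> ->] := gtangent_chart te ap bp; have [-> ->] := gtangent_chart tf ap bp.
by rewrite !dot_mulmx !trmxK -!mulmxA !jacV // !mulmx1.
Qed.

Lemma orthogonal_chart p e f a : gtangent p e -> gtangent p f -> dom_ a p ->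
  orthogonal_at p e f <-> vpair (chart_comp a e) (chart_comp a f) = 0.
Proof.
move=> te tf ap; rewrite -pairingE; split=> [|E b bp]; first exact.
by rewrite (pairing_chart te tf ap bp).
Qed.

(** For [p] in the domain of [a], the inverse of [chart_comp a] on [gtangent p]: the transformation
    laws force the components in the other charts around [p]. *)
Definition extend a p (w : vec) : gvec X :=
  (fun b => if p \in dom_ b then w.1 *m transition_jac a b p else 0,
   fun b => if p \in dom_ b then w.2 *m (transition_jac b a p)^T else 0).

Lemma comp_extend a p w : dom_ a p -> chart_comp a (extend a p w) = w.
Proof.
by move=> ap; rewrite /chart_comp /= mem_set // jac_id // trmx1 !mulmx1; case: w.
Qed.

Lemma extend_gtangent a p w : dom_ a p -> gtangent p (extend a p w).
Proof.
move=> ap; split; split=> [b nb|b c bp cp] /=.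
- by rewrite memNset.
- by rewrite (mem_set bp) (mem_set cp) -mulmxA (jac_comp ap bp cp).
- by rewrite memNset.
- by rewrite (mem_set bp) (mem_set cp) -mulmxA -trmx_mul (jac_comp bp cp ap).
Qed.

Lemma gtangent_eq a p e f : dom_ a p -> gtangent p e -> gtangent p f ->
  chart_comp a e = chart_comp a f -> e = f.
Proof.
move=> ap te tf [E1 E2].
have E b : e.1 b = f.1 b /\ e.2 b = f.2 b.
  have [bp|bp] := pselect (dom_ b p).
    have [-> ->] := gtangent_chart te ap bp; have [-> ->] := gtangent_chart tf ap bp.
    by rewrite E1 E2.
  by case: te tf => -[e1 _] [e2 _] [[f1 _] [f2 _]]; rewrite e1 // e2 // f1 // f2.
case: e f {te tf E1 E2} E => [e1 e2] [f1 f2] /= E.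
by congr (_, _); apply/funext => b; case: (E b).
Qed.

Lemma compD a e f : chart_comp a (e + f) = chart_comp a e + chart_comp a f.
Proof. by []. Qed.

Lemma compZ a (k : R) e : chart_comp a (k *: e) = k *: chart_comp a e.
Proof. by []. Qed.

Lemma comp0 a : chart_comp a (0 : gvec X) = 0.
Proof. by []. Qed.

Lemma comp_sum a (I : finType) (k : I -> R) (e : I -> gvec X) :
  chart_comp a (\sum_i k i *: e i) = \sum_i k i *: chart_comp a (e i).
Proof.
by elim: (index_enum I) => [|i s IH]; rewrite ?big_nil // !big_cons compD IH.
Qed.

Lemma gtangent0 p : gtangent p (0 : gvec X).
Proof. by split; split=> // a b _ _ /=; rewrite mul0mx. Qed.

Lemma gtangentD p e f : gtangent p e -> gtangent p f -> gtangent p (e + f).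
Proof.
case=> -[e1 E1] [e2 E2] [[f1 F1] [f2 F2]]; split; split=> [a na|a b ap bp] /=;
  rewrite /= !fctE.
- by rewrite e1 // f1 // addr0.
- by rewrite (E1 a b) // (F1 a b) // mulmxDl.
- by rewrite e2 // f2 // addr0.
- by rewrite (E2 a b) // (F2 a b) // mulmxDl.
Qed.

Lemma gtangentZ p (k : R) e : gtangent p e -> gtangent p (k *: e).
Proof.
case=> -[e1 E1] [e2 E2]; split; split=> [a na|a b ap bp] /=; rewrite !fctE.
- by rewrite e1 // scaler0.
- by rewrite (E1 a b) // scalemxAl.
- by rewrite e2 // scaler0.
- by rewrite (E2 a b) // scalemxAl.
Qed.

Lemma gtangent_sum p (I : finType) (k : I -> R) (e : I -> gvec X) :
  (forall i, gtangent p (e i)) -> gtangent p (\sum_i k i *: e i).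
Proof.
move=> H; elim: (index_enum I) => [|i s IH]; first by rewrite big_nil; exact: gtangent0.
by rewrite big_cons; apply: gtangentD => //; exact: gtangentZ.
Qed.

(** Smoothness is demanded in every chart [b]. There the components are those in [a], composed with
    the transition map and multiplied by entries of a Jacobian, which are smooth. *)
Lemma extend_section (U : set X) a (x xi : 'rV[R]_n -> 'rV[R]_n) : open U ->
  U `<=` dom_ a ->
  (forall j, csmooth (crd_ a @` (dom_ a `&` U)) (fun u => x u 0 j)) ->
  (forall j, csmooth (crd_ a @` (dom_ a `&` U)) (fun u => xi u 0 j)) ->
  is_section U (fun q => extend a q (x (crd_ a q), xi (crd_ a q))).
Proof.
move=> oU Ua sx sxi.
have oW b : open (crd_ b @` (dom_ b `&` U)) by exact: open_crd.
have tW b u : (crd_ b @` (dom_ b `&` U)) u -> (crd_ a @` (dom_ a `&` U)) (trans b a u).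
  by case=> q [bq Uq] <-; rewrite transE //; exists q => //; split => //; exact: Ua.
have tW2 b u : (crd_ b @` (dom_ b `&` U)) u ->
    (crd_ a @` (dom_ a `&` dom_ b)) (trans b a u).
  by case=> q [bq Uq] <-; rewrite transE //; exists q => //; split => //; exact: Ua.
have st b j : csmooth (crd_ b @` (dom_ b `&` U)) (fun u => trans b a u 0 j).
  apply: smooth_sub (trans_csmooth b a j).
  by move=> _ [q [bq Uq] <-]; exists q => //; split => //; exact: Ua.
split=> [q Uq|b|b]; first exact/extend_gtangent/Ua.
- apply/smooth_mapE => j; apply: (@smooth_eq _ _ _ (fun u =>
    \sum_i x (trans b a u) 0 i * pderiv i (fun w => trans a b w 0 j) (trans b a u))) => //.
    move=> _ [q [bq Uq] <-]; have aq := Ua _ Uq.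
    rewrite transE // crdK //= mem_set // mxE; apply: eq_bigr => i _.
    by rewrite transition_jacE // mxE.
  apply: smooth_sum => // i; apply: smoothM => //.
    exact: (smooth_comp (oW b) (oW a) (tW b) (sx i)).
  exact: (smooth_comp (oW b) (@open_overlap _ _ _ a b) (tW2 b)
    (smooth_pderiv i (trans_csmooth a b j)) (st b)).
(* Covectors involve the Jacobian from [b] to [a] at [u] itself, whereas vectors involved the one
   from [a] to [b] at the image of [u]. *)
- apply/smooth_mapE => j; apply: (@smooth_eq _ _ _ (fun u =>
    \sum_i xi (trans b a u) 0 i * pderiv j (fun w => trans b a w 0 i) u)) => //.
    move=> _ [q [bq Uq] <-]; have aq := Ua _ Uq.
    rewrite transE // crdK //= mem_set // mxE; apply: eq_bigr => i _.
    by rewrite transition_jacE // !mxE.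
  apply: smooth_sum => // i; apply: smoothM => //.
    exact: (smooth_comp (oW b) (oW a) (tW b) (sxi i)).
  exact: smooth_pderiv.
Qed.

End generalized_tangent_vectors.

(** * The Dorfman bracket *)

Section flat_brackets.
Context {R : realType} {n : nat}.
Implicit Types (x y al be : 'rV[R]_n -> 'rV[R]_n) (u : 'rV[R]_n).

Local Notation e_ i := (delta_mx 0 i : 'rV[R]_n).

(** Rows index the direction of differentiation, so [y u *m grad x u] is the derivative of [x] along
    [y]. *)
Definition grad x u : 'M[R]_n := \matrix_(j, i) pderiv j (fun w => x w 0 i) u.

Lemma lie_bracketE x y u :
  lie_bracket x y u = x u *m grad y u - y u *m grad x u.
Proof.
apply/rowP => i; rewrite !mxE -sumrB; apply: eq_bigr => j _.
by rewrite !mxE partialE.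
Qed.

Lemma lie_derivativeE x be u :
  lie_derivative x be u = x u *m grad be u + be u *m (grad x u)^T.
Proof.
apply/rowP => i; rewrite !mxE -big_split; apply: eq_bigr => j _.
by rewrite !mxE partialE.
Qed.

Lemma ext_derivE al u : ext_deriv al u = grad al u - (grad al u)^T.
Proof. by apply/matrixP => i j; rewrite !mxE partialE. Qed.

Lemma contract2E (x : 'rV[R]_n) (w : 'M[R]_n) : contract2 x w = x *m w.
Proof. by apply/rowP => i; rewrite !mxE. Qed.

Lemma near_grad x y u : (\near u, x u = y u) -> grad x u = grad y u.
Proof.
move=> xy; apply/matrixP => i j; rewrite !mxE; apply: near_pderiv.
by apply: filterS xy => w ->.
Qed.

Lemma grad_comp x (phi : 'rV[R]_n -> 'rV[R]_n) u :
  (forall j, differentiable (fun w => x w 0 j) (phi u)) ->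
  (forall j, differentiable (fun w => phi w 0 j) u) ->
  grad (x \o phi) u = grad phi u *m grad x (phi u).
Proof.
move=> dx dphi; apply/matrixP => i j; rewrite !mxE.
rewrite (@pderiv_comp _ _ _ (fun w => x w 0 j) phi) //.
by apply: eq_bigr => l _; rewrite !mxE.
Qed.

(** The part of the derivative of a product [x *m M] in which [M] is differentiated. For [M] a
    Jacobian matrix it consists of second derivatives. *)
Definition hess (x : 'rV[R]_n) (M : 'rV[R]_n -> 'M[R]_n) u : 'M[R]_n :=
  \matrix_(j, l) \sum_i x 0 i * pderiv j (fun w => M w i l) u.

Lemma grad_mulmx x (M : 'rV[R]_n -> 'M[R]_n) u :
  (forall i j, derivable (fun w => x w 0 i) u (e_ j)) ->
  (forall i k j, derivable (fun w => M w i k) u (e_ j)) ->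
  grad (fun w => x w *m M w) u = grad x u *m M u + hess (x u) M u.
Proof.
move=> dx dM; apply/matrixP => j l; rewrite !mxE.
under eq_fun do rewrite mxE.
rewrite pderiv_sumM // big_split /= addrC; congr (_ + _).
by apply: eq_bigr => i _; rewrite !mxE mulrC.
Qed.

End flat_brackets.

(* [J] is the Jacobian matrix of the change of coordinates from an unprimed to
   a primed chart, the [D]s are matrices of partial derivatives of components,
   and [Sx], [Sy], [Ta], [Tb] collect the terms with second derivatives of the
   coordinate change; their symmetries express Clairaut's theorem. *)
Section change_of_chart.
Context {R : realType} {n : nat}.
Variable J : 'M[R]_n.
Variables (x y al be : 'rV[R]_n) (Dx Dy Da Db : 'M[R]_n).
Variables (x' y' al' be' : 'rV[R]_n) (Dx' Dy' Da' Db' : 'M[R]_n).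
Variables (Sx Sy Ta Tb : 'M[R]_n).
Hypotheses (xE : x' = x *m J) (yE : y' = y *m J).
Hypotheses (alE : al = al' *m J^T) (beE : be = be' *m J^T).
Hypotheses (DxE : J *m Dx' = Dx *m J + Sx) (DyE : J *m Dy' = Dy *m J + Sy).
Hypotheses (DaE : Da = J *m Da' *m J^T + Ta) (DbE : Db = J *m Db' *m J^T + Tb).
Hypotheses (xSy : x *m Sy = y *m Sx) (Ta_sym : Ta^T = Ta).
Hypothesis (beSx : be' *m Sx^T = x *m Tb).

Lemma lie_bracket_chart :
  x' *m Dy' - y' *m Dx' = (x *m Dy - y *m Dx) *m J.
Proof.
rewrite xE yE -!mulmxA DxE DyE !mulmxDr xSy mulmxBl !mulmxA.
by rewrite opprD addrACA subrr addr0.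
Qed.

(** The second-order term from differentiating the covector along [x] cancels the one from
    differentiating [x] itself; this cancellation is [beSx]. *)
Lemma lie_derivative_chart :
  x *m Db + be *m Dx^T = (x' *m Db' + be' *m Dx'^T) *m J^T.
Proof.
have E : J^T *m Dx^T = Dx'^T *m J^T - Sx^T.
  by rewrite -!trmx_mul DxE linearD /= addrK.
rewrite beE -mulmxA E DbE mulmxDr mulmxBr beSx addrACA subrr addr0.
by rewrite mulmxDl xE !mulmxA.
Qed.

(** The second-order term is symmetric, so antisymmetrization removes it. *)
Lemma ext_deriv_chart :
  y *m (Da - Da^T) = (y' *m (Da' - Da'^T)) *m J^T.
Proof.
have -> : Da - Da^T = J *m (Da' - Da'^T) *m J^T.
  rewrite DaE linearD /= Ta_sym opprD addrACA subrr addr0 mulmxBr mulmxBl.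
  by rewrite !trmx_mul trmxK mulmxA.
by rewrite yE !mulmxA.
Qed.

End change_of_chart.

Section dorfman_bracket.
Context {R : realType} {n : nat} {X : manifold R n}.
Implicit Types (a b : idx X) (p q : X) (e f : X -> gvec X) (U : set X).

Local Notation dom_ a := (dom (atlas a)).
Local Notation crd_ a := (crd (atlas a)).
Local Notation par_ a := (par (atlas a)).
Local Notation e_ i := (delta_mx 0 i : 'rV[R]_n).

Definition tan_at e a : 'rV[R]_n -> 'rV[R]_n := fun u => (e (par_ a u)).1 a.
Definition cot_at e a : 'rV[R]_n -> 'rV[R]_n := fun u => (e (par_ a u)).2 a.

Lemma dorfmanE H e f p a : dom_ a p ->
  let u := crd_ a p in
  (dorfman H e f p).1 a = tan_at e a u *m grad (tan_at f a) u
    - tan_at f a u *m grad (tan_at e a) u /\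
  (dorfman H e f p).2 a = tan_at e a u *m grad (cot_at f a) u
    + cot_at f a u *m (grad (tan_at e a) u)^T
    - tan_at f a u *m (grad (cot_at e a) u - (grad (cot_at e a) u)^T)
    + tan_at f a u *m contract3 (tan_at e a u) (H p a).
Proof.
move=> ap /=; rewrite (mem_set ap) lie_bracketE lie_derivativeE ext_derivE !contract2E.
by [].
Qed.

Lemma section_csmooth U e a j : is_section U e ->
  csmooth (crd_ a @` (dom_ a `&` U)) (fun u => tan_at e a u 0 j) /\
  csmooth (crd_ a @` (dom_ a `&` U)) (fun u => cot_at e a u 0 j).
Proof.
by case=> _ /(_ a)/smooth_mapE/(_ j) s1 /(_ a)/smooth_mapE/(_ j) s2.
Qed.

Lemma section_chart U e a b q : is_section U e -> U q -> dom_ a q -> dom_ b q ->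
  tan_at e b (crd_ b q) = tan_at e a (crd_ a q) *m grad (trans a b) (crd_ a q) /\
  cot_at e a (crd_ a q) = cot_at e b (crd_ b q) *m (grad (trans a b) (crd_ a q))^T.
Proof.
move=> [te _ _] Uq aq bq; rewrite /tan_at /cot_at !crdK //.
have -> : grad (trans a b) (crd_ a q) = transition_jac a b q.
  by rewrite transition_jacE.
have [E1 _] := gtangent_chart (te q Uq) aq bq.
by have [_ E2] := gtangent_chart (te q Uq) bq aq.
Qed.

(** Contraction with [x] absorbs the Jacobian of the first slot of H; those of the other two slots
    remain as left and right factors. *)
Lemma contract3_chart H a b q (x : 'rV[R]_n) : is_3form H -> dom_ a q -> dom_ b q ->
  let J := transition_jac a b q in
  contract3 x (H q a) = J *m contract3 (x *m J) (H q b) *m J^T.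
Proof.
move=> [tH _ _] aq bq J; have := tH q a b aq bq; rewrite -/J.
move: J => J tJ; apply/matrixP => j k; rewrite !mxE.
pose T i i' j' k' := x 0 i * (J i i' * J j j' * J k k' * H q b i' j' k').
transitivity (\sum_k' \sum_j' \sum_i' \sum_i T i i' j' k').
  transitivity (\sum_i \sum_i' \sum_j' \sum_k' T i i' j' k').
    apply: eq_bigr => i _; rewrite tJ mulr_sumr.
    by do 2![apply: eq_bigr => ? _; rewrite mulr_sumr].
  rewrite exchange_big /=; under eq_bigr do rewrite exchange_big /=.
  rewrite exchange_big /=; under eq_bigr do under eq_bigr do rewrite exchange_big /=.
  under eq_bigr do rewrite exchange_big /=.
  by rewrite exchange_big.
apply: eq_bigr => k' _; rewrite !mxE mulr_suml; apply: eq_bigr => j' _.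
rewrite !mxE mulr_sumr mulr_suml; apply: eq_bigr => i' _.
rewrite !mxE mulr_suml mulr_sumr mulr_suml; apply: eq_bigr => i _.
by rewrite /T; ring.
Qed.

(** The bracket is invariant under changes of chart: the transformation laws of both sections are
    differentiated, and the second-order terms cancel by the matrix identities for a change of
    chart. *)
Lemma dorfman_gtangent U H e f q : is_3form H -> open U ->
  is_section U e -> is_section U f -> U q -> gtangent q (dorfman H e f q).
Proof.
move=> fH oU se sf Uq.
suff main a b : dom_ a q -> dom_ b q ->
    (dorfman H e f q).1 b = (dorfman H e f q).1 a *m transition_jac a b q /\
    (dorfman H e f q).2 a = (dorfman H e f q).2 b *m (transition_jac a b q)^T.
  split; split=> [a na|a b aq bq]; try by rewrite /= memNset.
    exact: (main a b aq bq).1.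
  exact: (main a b aq bq).2.
move=> aq bq; have [-> ->] := dorfmanE H e f aq; have [-> ->] := dorfmanE H e f bq.
set u := crd_ a q; set v := crd_ b q; set phi := trans a b.
have phiu : phi u = v by exact: transE.
have JE : transition_jac a b q = grad phi u by rewrite transition_jacE.
set J := grad phi u in JE *; rewrite JE.
have oUb : open (U `&` dom_ b) by apply: openI => //; exact: open_dom.
have dphi j : differentiable (fun w => phi w 0 j) u by exact: trans_differentiable.
have iu (c : idx X) : dom_ c q -> (crd_ c @` (dom_ c `&` U)) (crd_ c q).
  by move=> cq; exists q.
have oW c : open (crd_ c @` (dom_ c `&` U)) by exact: open_crd.
have ds (s : X -> gvec X) c j : is_section U s -> dom_ c q ->
    differentiable (fun w => tan_at s c w 0 j) (crd_ c q) /\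
    differentiable (fun w => cot_at s c w 0 j) (crd_ c q).
  move=> ss cq; have [s1 s2] := section_csmooth c j ss.
  by split; [apply: smooth_differentiable s1 (iu c cq) |
             apply: smooth_differentiable s2 (iu c cq)].
have dJ i k j : derivable (fun w => grad phi w i k) u (e_ j).
  under eq_fun do rewrite mxE.
  apply: smooth_derivable (smooth_pderiv i (trans_csmooth a b k)) _.
  by exists q.
(* Clairaut's theorem for the coordinate change; all symmetries of the second-order terms below come
   from it. *)
have ddphi i j k : pderiv i (fun w => grad phi w j k) u =
    pderiv j (fun w => grad phi w i k) u.
  under eq_fun do rewrite mxE; under [in RHS]eq_fun do rewrite mxE.
  apply: pderivC (trans_csmooth a b k) _; first exact: open_overlap.
  by exists q.
(* The vector law is differentiated near [q]: the chain rule on the side of [b], the product rule on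
   the side of [a]. *)
have DT (s : X -> gvec X) : is_section U s ->
    J *m grad (tan_at s b) v = grad (tan_at s a) u *m J + hess (tan_at s a u) (grad phi) u.
  move=> ss; rewrite -grad_mulmx => [|i j|//]; last first.
    by apply: diff_derivable; exact: (ds s a i ss aq).1.
  rewrite -phiu -grad_comp //; last first.
    by move=> j; rewrite phiu; exact: (ds s b j ss bq).1.
  apply: near_grad; apply: near_crd oUb (conj Uq bq) aq _ => q' aq' [Uq' bq'] /=.
  by rewrite /phi transE // (section_chart ss Uq' aq' bq').1.
(* For covectors the components in [b] carry the Jacobian, so chain and product rule both act on
   that side. *)
have DC (s : X -> gvec X) : is_section U s ->
    grad (cot_at s a) u = J *m grad (cot_at s b) v *m J^T +
      hess (cot_at s b v) (fun w => (grad phi w)^T) u.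
  move=> ss; rewrite -phiu -grad_comp //; last first.
    by move=> j; rewrite phiu; exact: (ds s b j ss bq).2.
  have := @grad_mulmx R n (cot_at s b \o phi) (fun w => (grad phi w)^T) u.
  rewrite /= => <-.
  - apply: near_grad; apply: near_crd oUb (conj Uq bq) aq _ => q' aq' [Uq' bq'] /=.
    by rewrite /phi transE // (section_chart ss Uq' aq' bq').2.
  - move=> i j; apply: diff_derivable.
    apply: (@differentiable_comp _ _ _ _ phi (fun w => cot_at s b w 0 i)).
      exact: differentiable_row.
    by rewrite phiu; exact: (ds s b i ss bq).2.
  - by move=> i k j; under eq_fun do rewrite mxE; exact: dJ.
have [xE alE] := section_chart se Uq aq bq.
have [yE beE] := section_chart sf Uq aq bq.
have xSy : tan_at e a u *m hess (tan_at f a u) (grad phi) u =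
           tan_at f a u *m hess (tan_at e a u) (grad phi) u.
  apply/rowP => l; rewrite !mxE.
  under eq_bigr do rewrite mxE big_distrr /=.
  under [RHS]eq_bigr do rewrite mxE big_distrr /=.
  rewrite exchange_big; apply: eq_bigr => i _; apply: eq_bigr => j _ /=.
  by rewrite ddphi mulrCA.
have Tsym z : (hess z (fun w => (grad phi w)^T) u)^T = hess z (fun w => (grad phi w)^T) u.
  apply/matrixP => i j; rewrite !mxE; apply: eq_bigr => l _; congr (_ * _).
  under eq_fun do rewrite mxE; under [in RHS]eq_fun do rewrite mxE.
  exact: ddphi.
have beSx : cot_at f b v *m (hess (tan_at e a u) (grad phi) u)^T =
    tan_at e a u *m hess (cot_at f b v) (fun w => (grad phi w)^T) u.
  apply/rowP => j; rewrite !mxE.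
  under eq_bigr do rewrite !mxE big_distrr /=.
  under [RHS]eq_bigr do rewrite mxE big_distrr /=.
  rewrite exchange_big; apply: eq_bigr => i _; apply: eq_bigr => l _ /=.
  under [in RHS]eq_fun do rewrite mxE.
  by rewrite ddphi mulrCA.
split; first exact: lie_bracket_chart xE yE (DT _ se) (DT _ sf) xSy.
rewrite (contract3_chart _ fH aq bq) JE -/J (_ : tan_at e a u *m J = tan_at e b v) //.
rewrite (lie_derivative_chart xE beE (DT _ se) (DC _ sf) beSx).
rewrite (ext_deriv_chart yE (DC _ se) (Tsym _)).
by rewrite [RHS]mulmxDl [in RHS]mulmxBl yE !mulmxA.
Qed.

Lemma dorfman_section U H e f : is_3form H -> open U ->
  is_section U e -> is_section U f -> is_section U (dorfman H e f).
Proof.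
move=> fH oU se sf.
have oW a : open (crd_ a @` (dom_ a `&` U)) by exact: open_crd.
have sg (s : X -> gvec X) a i j : is_section U s ->
    csmooth (crd_ a @` (dom_ a `&` U)) (fun u => grad (tan_at s a) u i j) /\
    csmooth (crd_ a @` (dom_ a `&` U)) (fun u => grad (cot_at s a) u i j).
  move=> ss; have [s1 s2] := section_csmooth a j ss.
  by split; under eq_fun do rewrite mxE; exact: smooth_pderiv.
split; first by move=> q Uq; exact: dorfman_gtangent fH oU se sf Uq.
- move=> a; apply/smooth_mapE => j.
  apply: (@smooth_eq _ _ _ (fun u => \sum_i tan_at e a u 0 i * grad (tan_at f a) u i j
     - \sum_i tan_at f a u 0 i * grad (tan_at e a) u i j)) => //.
    move=> _ [q [aq Uq] <-]; rewrite crdK //.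
    by have [-> _] := dorfmanE H e f aq; rewrite !mxE.
  apply: smoothB => //; apply: smooth_sum => // i; apply: smoothM => //.
  + exact: (section_csmooth a i se).1.
  + exact: (sg f a i j sf).1.
  + exact: (section_csmooth a i sf).1.
  + exact: (sg e a i j se).1.
- move=> a; apply/smooth_mapE => j.
  have sH i k l : csmooth (crd_ a @` (dom_ a `&` U)) (fun u => H (par_ a u) a i k l).
    have [_ _ /(_ a i k l)] := fH; rewrite smoothE; apply: smooth_sub.
    by move=> _ [q [aq Uq] <-]; exists q.
  apply: (@smooth_eq _ _ _ (fun u =>
     \sum_i tan_at e a u 0 i * grad (cot_at f a) u i j
     + \sum_i cot_at f a u 0 i * grad (tan_at e a) u j i
     - \sum_i tan_at f a u 0 i * (grad (cot_at e a) u i j - grad (cot_at e a) u j i)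
     + \sum_i tan_at f a u 0 i *
        (\sum_k tan_at e a u 0 k * H (par_ a u) a k i j))) => //.
    move=> _ [q [aq Uq] <-]; rewrite crdK //.
    have [_ ->] := dorfmanE H e f aq; rewrite !mxE.
    by congr (_ + _ - _ + _); apply: eq_bigr => i _; rewrite !mxE.
  apply: smoothD => //; first apply: smoothB => //; first apply: smoothD => //.
  + apply: smooth_sum => // i; apply: smoothM => //.
      exact: (section_csmooth a i se).1.
    exact: (sg f a i j sf).2.
  + apply: smooth_sum => // i; apply: smoothM => //.
      exact: (section_csmooth a i sf).2.
    exact: (sg e a j i se).1.
  + apply: smooth_sum => // i; apply: smoothM => //.
      exact: (section_csmooth a i sf).1.
    by apply: smoothB => //; [exact: (sg e a i j se).2|exact: (sg e a j i se).2].
  + apply: smooth_sum => // i; apply: smoothM => //.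
      exact: (section_csmooth a i sf).1.
    apply: smooth_sum => // k; apply: smoothM => //.
    exact: (section_csmooth a k se).1.
Qed.

End dorfman_bracket.

(** * Gauge transformations *)

Section gauge_transformation.
Context {R : realType} {n : nat}.

Local Notation e_ i := (delta_mx 0 i : 'rV[R]_n).
Local Notation vec := ('rV[R]_n * 'rV[R]_n)%type.

(** The B-field transformation: [w.1 *m B] is the contraction of the 2-form with matrix [B] by the
    vector [w.1]. *)
Definition shear (B : 'M[R]_n) (w : vec) : vec := (w.1, w.2 + w.1 *m B).

Definition swap (w : vec) : vec := (w.2, w.1).

Lemma shearD B (w z : vec) : shear B (w + z) = shear B w + shear B z.
Proof. by rewrite /shear /= mulmxDl addrACA. Qed.

Lemma shearZ B (k : R) (w : vec) : shear B (k *: w) = k *: shear B w.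
Proof. by rewrite /shear /= -scalemxAl -scalerDr. Qed.

Lemma shear0 B : shear B (0 : vec) = 0.
Proof. by rewrite /shear /= mul0mx addr0. Qed.

Lemma shear_sum B (I : finType) (k : I -> R) (w : I -> vec) :
  shear B (\sum_i k i *: w i) = \sum_i k i *: shear B (w i).
Proof.
elim: (index_enum I) => [|i s IH]; first by rewrite !big_nil shear0.
by rewrite !big_cons shearD shearZ IH.
Qed.

Lemma shearK B : cancel (shear B) (shear (- B)).
Proof. by case=> x al; rewrite /shear /= mulmxN addrK. Qed.

Lemma shearNK B : cancel (shear (- B)) (shear B).
Proof. by case=> x al; rewrite /shear /= mulmxN subrK. Qed.

(** For antisymmetric [B] the shear is an isometry of the pairing; moving it across the pairing
    inverts it. *)
Lemma vpair_shear (B : 'M[R]_n) (w z : vec) : B^T = - B ->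
  vpair (shear B w) z = vpair w (shear (- B) z).
Proof.
by move=> aB; rewrite /vpair /= !dotDl dot_mulmx aB [dot w.1 _]dotC; ring.
Qed.

Lemma swapK : cancel swap swap.
Proof. by case. Qed.

Lemma swap_sum (I : finType) (k : I -> R) (w : I -> vec) :
  swap (\sum_i k i *: w i) = \sum_i k i *: swap (w i).
Proof.
by elim: (index_enum I) => [|i s IH]; rewrite ?big_nil // !big_cons -IH.
Qed.

Lemma vpair_swap (w z : vec) : vpair (swap w) z = vpair w (swap z).
Proof. by rewrite /vpair /= addrC (dotC z.1) (dotC w.2). Qed.

Lemma dot_ge0 (x : 'rV[R]_n) : 0 <= dot x x.
Proof. by rewrite dotE; apply: sumr_ge0 => i _; rewrite -expr2 sqr_ge0. Qed.

Lemma dot_eq0 (x : 'rV[R]_n) : dot x x = 0 -> x = 0.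
Proof.
rewrite dotE => /eqP; rewrite psumr_eq0 => [/allP H|i _]; last first.
  by rewrite -expr2 sqr_ge0.
apply/rowP => i; rewrite mxE; apply/eqP.
by have := H i (mem_index_enum i); rewrite mulf_eq0 orbb.
Qed.

Lemma vpair_swap_eq0 (w : vec) : vpair w (swap w) = 0 -> w = 0.
Proof.
case: w => x al; rewrite /vpair /= => /eqP; rewrite paddr_eq0 ?dot_ge0 //.
by case/andP=> /eqP/dot_eq0 -> /eqP/dot_eq0 ->.
Qed.

(** The relation is differentiated in every coordinate direction; [m] is constant, so only the
    derivatives of [x] and [xi] appear. *)
Lemma grad_orthogonal (x xi : 'rV[R]_n -> 'rV[R]_n) u (m : vec) :
  (forall i j, derivable (fun w => x w 0 i) u (e_ j)) ->
  (forall i j, derivable (fun w => xi w 0 i) u (e_ j)) ->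
  (\forall w \near u, vpair (x w, xi w) m = 0) ->
  grad x u *m m.2^T + grad xi u *m m.1^T = 0.
Proof.
move=> dx dxi H; apply/colP => k; rewrite !mxE.
have : pderiv k (fun w => \sum_i m.2 0 i * x w 0 i + \sum_i m.1 0 i * xi w 0 i) u = 0.
  rewrite (@near_pderiv _ _ _ (cst 0)) ?pderiv_cst //.
  apply: filterS H => w E; rewrite /= -[RHS]E /vpair !dotE; congr (_ + _).
  by apply: eq_bigr => i _; rewrite mulrC.
have dc (z : 'rV[R]_n) (i : 'I_n) : derivable (cst (z 0 i) : 'rV[R]_n -> R) u (e_ k).
  exact: derivable_cst.
have dM (z : 'rV[R]_n) (y : 'rV[R]_n -> 'rV[R]_n) :
    (forall i j, derivable (fun w => y w 0 i) u (e_ j)) ->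
    derivable (fun w => \sum_i z 0 i * y w 0 i) u (e_ k) /\
    pderiv k (fun w => \sum_i z 0 i * y w 0 i) u = \sum_i grad y u k i * z^T i 0.
  move=> dy; split; first by apply: derivable_sumM => i; [exact: dc|exact: dy].
  rewrite (@pderiv_sumM _ _ _ (fun i => cst (z 0 i)) (fun i w => y w 0 i)) //.
  by apply: eq_bigr => i _; rewrite pderiv_cst mulr0 addr0 !mxE mulrC.
by rewrite pderivD ?(dM _ _ dx).2 ?(dM _ _ dxi).2 //; [exact: (dM _ _ dx).1|exact: (dM _ _ dxi).1].
Qed.

Lemma flat_dorfman_orthogonal (x y xi eta : 'rV[R]_n -> 'rV[R]_n) u (m : vec) :
  (forall i j, derivable (fun w => x w 0 i) u (e_ j)) ->
  (forall i j, derivable (fun w => y w 0 i) u (e_ j)) ->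
  (forall i j, derivable (fun w => xi w 0 i) u (e_ j)) ->
  (forall i j, derivable (fun w => eta w 0 i) u (e_ j)) ->
  (\forall w \near u, vpair (x w, xi w) m = 0) ->
  (\forall w \near u, vpair (y w, eta w) m = 0) ->
  (\forall w \near u, vpair (x w, xi w) (y u, eta u) = 0) ->
  vpair (x u *m grad y u - y u *m grad x u,
         x u *m grad eta u + eta u *m (grad x u)^T
           - y u *m (grad xi u - (grad xi u)^T)) m = 0.
Proof.
move=> dx dy dxi deta xm ym xy.
have Ex := grad_orthogonal dx dxi xm; have Ey := grad_orthogonal dy deta ym.
have Exy := grad_orthogonal dx dxi xy; rewrite /= in Exy.
have E : eta u *m (grad x u)^T = - (y u *m (grad xi u)^T).
  apply/eqP; rewrite -subr_eq0 opprK -[_ *m _ + _]trmxK linearD /= !trmx_mul !trmxK.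
  by rewrite Exy trmx0.
rewrite /vpair /= dotC /dot.
have -> : (x u *m grad eta u + eta u *m (grad x u)^T
           - y u *m (grad xi u - (grad xi u)^T)) =
   x u *m grad eta u - y u *m grad xi u.
  by rewrite E mulmxBr opprB addrA subrK.
suff : (x u *m grad y u - y u *m grad x u) *m m.2^T +
  (x u *m grad eta u - y u *m grad xi u) *m m.1^T = 0.
  by move=> /matrixP/(_ 0 0); rewrite !mxE.
rewrite !mulmxBl addrACA -opprD -!mulmxA -!mulmxDr Ex Ey !mulmx0 subr0 //.
Qed.

(** If dB = h, the shear by B intertwines the h-twisted and the untwisted bracket. Only covector
    parts are compared, as the shear fixes vector parts; the last term on the left is the shear
    acting on the Lie bracket. *)
Lemma gauge (x y al be : 'rV[R]_n -> 'rV[R]_n) (B : 'rV[R]_n -> 'M[R]_n)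
    (h : 'I_n -> 'I_n -> 'I_n -> R) u :
  (forall i j, derivable (fun w => x w 0 i) u (e_ j)) ->
  (forall i j, derivable (fun w => y w 0 i) u (e_ j)) ->
  (forall i j, derivable (fun w => al w 0 i) u (e_ j)) ->
  (forall i j, derivable (fun w => be w 0 i) u (e_ j)) ->
  (forall i j k, derivable (fun w => B w i j) u (e_ k)) ->
  (B u)^T = - B u ->
  (forall i j k, pderiv i (fun w => B w j k) u - pderiv j (fun w => B w i k) u
     + pderiv k (fun w => B w i j) u = h i j k) ->
  let xi w := al w + x w *m B w in
  let eta w := be w + y w *m B w in
  x u *m grad be u + be u *m (grad x u)^T - y u *m (grad al u - (grad al u)^T)
    + y u *m contract3 (x u) h + (x u *m grad y u - y u *m grad x u) *m B u
  = x u *m grad eta u + eta u *m (grad x u)^T - y u *m (grad xi u - (grad xi u)^T).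
Proof.
move=> dx dy dal dbe dB aB dBh xi eta.
have dxB (z : 'rV[R]_n -> 'rV[R]_n) : (forall i j, derivable (fun w => z w 0 i) u (e_ j)) ->
    forall i j, derivable (fun w => (z w *m B w) 0 i) u (e_ j).
  move=> dz i j; under eq_fun do rewrite mxE.
  by apply: derivable_sumM => l; [exact: dz|exact: dB].
have gxB (z ga : 'rV[R]_n -> 'rV[R]_n) : (forall i j, derivable (fun w => z w 0 i) u (e_ j)) ->
    (forall i j, derivable (fun w => ga w 0 i) u (e_ j)) ->
    grad (fun w => ga w + z w *m B w) u =
    grad ga u + (grad z u *m B u + hess (z u) B u).
  move=> dz dga; rewrite -grad_mulmx //; apply/matrixP => j l; rewrite !mxE -pderivD //.
    by congr (pderiv _ _ _); apply/funext => w; rewrite !mxE.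
  exact: dxB.
(* The terms in which B is differentiated assemble into the double contraction of dB. *)
have K : x u *m hess (y u) B u - y u *m hess (x u) B u + y u *m (hess (x u) B u)^T
   = y u *m contract3 (x u) h.
  apply/rowP => k; rewrite !mxE.
  rewrite [X in X - _](_ : _ = \sum_j \sum_i x u 0 i * (y u 0 j * pderiv i (fun w => B w j k) u)).
    rewrite -sumrB -big_split; apply: eq_bigr => j _; rewrite !mxE !mulr_sumr.
    rewrite -sumrB -big_split; apply: eq_bigr => i _; rewrite /= -dBh; ring.
  rewrite exchange_big; apply: eq_bigr => i _; rewrite mxE mulr_sumr.
  by apply: eq_bigr.
rewrite (gxB y be dy dbe) (gxB x al dx dal) -K /eta.
have -> : (grad al u + (grad x u *m B u + hess (x u) B u))^T =
    (grad al u)^T + (- (B u *m (grad x u)^T) + (hess (x u) B u)^T).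
  by rewrite !raddfD /= trmx_mul aB mulNmx.
rewrite !(mulmxDr, mulmxDl, mulmxN, mulNmx, opprD, opprK, mulmxA).
(* With the products made opaque, an identity in an additive group remains. *)
move: (x u *m grad be u) (be u *m (grad x u)^T) (y u *m grad al u) (y u *m (grad al u)^T)
  (x u *m hess (y u) B u) (y u *m hess (x u) B u) (y u *m (hess (x u) B u)^T)
  (x u *m grad y u *m B u) (y u *m grad x u *m B u) (y u *m B u *m (grad x u)^T).
move=> t1 t2 t3 t4 t5 t6 t7 t8 t9 t10.
apply/rowP => k; rewrite !mxE; ring.
Qed.

End gauge_transformation.

(** * Local complements *)

Section lagrangian_frames.
Context {R : realType} {n k : nat}.

Local Notation vec := ('rV[R]_n * 'rV[R]_n)%type.

(** A basis of a subspace equal to its own orthogonal. Self-orthogonality is split into isotropy and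
    maximality, so no dimension count is involved. *)
Definition lagrangian_frame (b : 'I_k -> vec) : Prop :=
  [/\ forall i j, vpair (b i) (b j) = 0,
      forall w, (forall j, vpair w (b j) = 0) -> exists c, w = \sum_i c i *: b i &
      forall c : 'I_k -> R, \sum_i c i *: b i = 0 -> forall i, c i = 0].

Lemma swap_frame (b : 'I_k -> vec) :
  lagrangian_frame b -> lagrangian_frame (fun i => swap (b i)).
Proof.
case=> iso maxi free; split.
- by move=> i j; rewrite vpair_swap swapK.
- move=> w H; have [j|c E] := maxi (swap w); first by rewrite vpair_swap.
  by exists c; rewrite -swap_sum -E swapK.
- by move=> c; rewrite -swap_sum => /(congr1 swap); rewrite swapK; exact: free.
Qed.

(* [swap] turns the pairing into the Euclidean inner product of R^(2n), so this
   is the Gram determinant of a free family. *)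
Lemma frame_gram_det (b : 'I_k -> vec) : lagrangian_frame b ->
  \det (\matrix_(i, j) vpair (b i) (swap (b j))) != 0.
Proof.
case=> _ _ free; set G := \matrix_(i, j) _.
apply/negP => /det0P[v vn0 vG].
(* A kernel row of the Gram matrix gives a combination that is Euclidean-orthogonal to every [b j],
   hence to itself. *)
have E : \sum_i v 0 i *: b i = 0.
  apply: vpair_swap_eq0; rewrite vpairC swap_sum vpair_suml big1 // => j _.
  rewrite vpairC vpair_suml.
  have /rowP/(_ j) := vG; rewrite !mxE => E.
  by rewrite (eq_bigr (fun i => v 0 i * G i j)) ?E ?mulr0 // => i _; rewrite mxE.
by case/eqP: vn0; apply/rowP => i; rewrite mxE (free _ E).
Qed.

End lagrangian_frames.

Section local_complements.
Context {R : realType} {n : nat} {X : manifold R n}.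
Implicit Types (a : idx X) (q : X) (U V : set X) (L : X -> set (gvec X)).

Local Notation dom_ a := (dom (atlas a)).
Local Notation crd_ a := (crd (atlas a)).
Local Notation vec := ('rV[R]_n * 'rV[R]_n)%type.

(** Verbatim the pointwise clause of [is_subbundle], so that local frames of a subbundle satisfy it
    by conversion. *)
Definition spans (k : nat) (s : 'I_k -> X -> gvec X) L q : Prop :=
  (forall e, L q e <-> exists c : 'I_k -> R, e = \sum_(i < k) c i *: s i q) /\
  (forall c : 'I_k -> R, \sum_(i < k) c i *: s i q = 0 -> forall i, c i = 0).

Lemma lagrangian_gtangent U L q e : is_lagrangian U L -> U q -> L q e ->
  gtangent q e.
Proof. by move=> [_ H] Uq; rewrite (H q Uq) => -[]. Qed.

Lemma span_mem k (s : 'I_k -> X -> gvec X) L q i : spans s L q -> L q (s i q).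
Proof.
move=> [sp _]; apply/sp; exists (fun j => (j == i)%:R).
rewrite (bigD1 i) //= eqxx scale1r big1 ?addr0 // => j /negbTE ->.
by rewrite scale0r.
Qed.

(** Maximality is the point: a pair of rows orthogonal to the frame in the chart [a] extends to a
    generalized tangent vector orthogonal to the whole fibre, which therefore lies in [L]. *)
Lemma span_frame U L q a k (s : 'I_k -> X -> gvec X) : is_lagrangian U L ->
  U q -> dom_ a q -> spans s L q -> lagrangian_frame (fun i => chart_comp a (s i q)).
Proof.
move=> LU Uq aq sp; have Ls i := span_mem i sp.
have ts i := lagrangian_gtangent LU Uq (Ls i).
have LE := LU.2 q Uq; have [spE free] := sp; split.
- move=> i j; apply/(orthogonal_chart (ts i) (ts j) aq).
  by move: (Ls i); rewrite {1}LE => -[_]; apply; exact: Ls.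
- move=> w H.
  have : L q (extend a q w).
    rewrite LE; split; first exact: extend_gtangent.
    move=> f Lf; have tf := lagrangian_gtangent LU Uq Lf.
    apply/(orthogonal_chart (extend_gtangent w aq) tf aq); rewrite comp_extend //.
    have /spE[c ->] := Lf; rewrite comp_sum vpairC vpair_suml big1 // => i _.
    by rewrite vpairC H mulr0.
  by move/spE => [c E]; exists c; rewrite -comp_sum -E comp_extend.
- move=> c E; apply: free; apply: (gtangent_eq aq).
  + exact: gtangent_sum.
  + exact: gtangent0.
  + by rewrite comp_sum.
Qed.

(* The image of the constant subbundle spanned by [m] in the chart [a] under
   [x + alpha |-> x + (alpha - iota_x B)]; it is cut out by orthogonality to [m]
   because the span of [m] is its own orthogonal. *)
Definition gauged a (B : 'rV[R]_n -> 'M[R]_n) k (m : 'I_k -> vec) : X -> set (gvec X) :=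
  fun q => [set e | gtangent q e /\
    forall j, vpair (shear (B (crd_ a q)) (chart_comp a e)) (m j) = 0].

Section gauged_structure.
Variables (a : idx X) (U : set X) (B : 'rV[R]_n -> 'M[R]_n) (k : nat).
Variable m : 'I_k -> vec.
Hypotheses (oU : open U) (Ua : U `<=` dom_ a) (m_frame : lagrangian_frame m).
Hypothesis sB : forall i j, csmooth (crd_ a @` (dom_ a `&` U)) (fun u => B u i j).
Hypothesis aB : forall q, U q -> (B (crd_ a q))^T = - B (crd_ a q).

Let t (j : 'I_k) (q : X) := extend a q (shear (- B (crd_ a q)) (m j)).

Lemma gauged_frame_mem j q : U q -> gauged a B m q (t j q).
Proof.
move=> Uq; have aq := Ua Uq; split; first exact: extend_gtangent.
by move=> i; rewrite comp_extend // shearNK; case: m_frame.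
Qed.

Lemma gauged_spans q : U q -> spans t (gauged a B m) q.
Proof.
move=> Uq; have aq := Ua Uq; have [iso maxi free] := m_frame.
have tt j : gtangent q (t j q) by exact: (gauged_frame_mem j Uq).1.
have ct c : chart_comp a (\sum_i c i *: t i q) =
    shear (- B (crd_ a q)) (\sum_i c i *: m i).
  rewrite comp_sum shear_sum; apply: eq_bigr => i _.
  by rewrite comp_extend.
split=> [e|c E]; last first.
  apply: free; rewrite -(shearNK (B (crd_ a q)) (\sum_i c i *: m i)) -ct E comp0.
  exact: shear0.
split=> [[te /maxi[c E]]|[c ->]].
  exists c; apply: (gtangent_eq aq te); first exact: gtangent_sum.
  by rewrite ct -E shearK.
split=> [|j]; first exact: gtangent_sum.
by rewrite ct shearNK vpair_suml big1 // => i _; rewrite iso mulr0.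
Qed.

Lemma gauged_section j : is_section U (t j).
Proof.
have oW := @open_crd _ _ _ (atlas a) U oU.
pose xi u := (m j).2 - (m j).1 *m B u.
have -> : t j = fun q => extend a q ((cst (m j).1) (crd_ a q), xi (crd_ a q)).
  by apply/funext => q; rewrite /t /shear mulmxN.
apply: extend_section => // i; first exact: smooth_cst.
apply: (@smooth_eq _ _ _ (fun u => cst ((m j).2 0 i) u -
  \sum_l cst ((m j).1 0 l) u * B u l i)) => //.
  by move=> u _; rewrite !mxE.
apply: smoothB => //; first exact: smooth_cst.
apply: smooth_sum => // l; apply: smoothM => //; exact: smooth_cst.
Qed.

(** The shear is an isometry, so the fibres inherit self-orthogonality from the span of [m]. *)
Lemma gauged_lagrangian : is_lagrangian U (gauged a B m).
Proof.
split=> [q Uq|q Uq].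
  exists U, k, t; split => //; first exact: gauged_section.
  exact: gauged_spans.
have aq := Ua Uq; have aBq := aB Uq.
have aBNq : (- B (crd_ a q))^T = - (- B (crd_ a q)) by rewrite linearN /= aBq.
apply/seteqP; split=> e [te He].
  split=> // f [tf Hf].
  apply/(orthogonal_chart te tf aq); have [_ maxi _] := m_frame.
  have [c E] := maxi _ Hf.
  rewrite -(shearK (B (crd_ a q)) (chart_comp a f)) -vpair_shear // vpairC E.
  by rewrite vpair_suml big1 // => i _; rewrite vpairC He mulr0.
split=> // j.
have Lt := gauged_frame_mem j Uq.
have /(orthogonal_chart te Lt.1 aq) := He _ Lt.
by rewrite comp_extend // vpair_shear.
Qed.

Lemma gauged_dirac (H : tensor3 X) : is_3form H ->
  (forall q, U q -> forall i j l,
     pderiv i (fun w => B w j l) (crd_ a q) - pderiv j (fun w => B w i l) (crd_ a q)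
     + pderiv l (fun w => B w i j) (crd_ a q) = H q a i j l) ->
  is_dirac U H (gauged a B m).
Proof.
move=> fH BH; split; first exact: gauged_lagrangian.
move=> e f [se Me] [sf Mf]; split; first exact: dorfman_section.
move=> q Uq; split; first exact: dorfman_gtangent fH oU se sf Uq.
move=> j; have aq := Ua Uq; set u := crd_ a q.
have oW := @open_crd _ _ _ (atlas a) U oU.
have Wu : (crd_ a @` (dom_ a `&` U)) u by exists q.
have [E1 E2] := dorfmanE H e f aq.
have dt (s : X -> gvec X) i l : is_section U s ->
    derivable (fun w => tan_at s a w 0 i) u (delta_mx 0 l) /\
    derivable (fun w => cot_at s a w 0 i) u (delta_mx 0 l).
  move=> ss; have [s1 s2] := section_csmooth a i ss.
  by split; [exact: smooth_derivable s1 Wu|exact: smooth_derivable s2 Wu].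
have dB i l r : derivable (fun w => B w i l) u (delta_mx 0 r).
  exact: smooth_derivable (sB i l) Wu.
pose xi (s : X -> gvec X) w := cot_at s a w + tan_at s a w *m B w.
have dxi (s : X -> gvec X) i l : is_section U s ->
    derivable (fun w => xi s w 0 i) u (delta_mx 0 l).
  move=> ss; rewrite (_ : (fun w => _) = (fun w => cot_at s a w 0 i) +
      (fun w => \sum_r tan_at s a w 0 r * B w r i)); last first.
    by apply/funext => w; rewrite !mxE !fctE.
  apply: derivableD; first exact: (dt s i l ss).2.
  by apply: derivable_sumM => r; [exact: (dt s r l ss).1|exact: dB].
have near_ort (s : X -> gvec X) (z : vec) :
    (forall q', U q' -> vpair (shear (B (crd_ a q')) (chart_comp a (s q'))) z = 0) ->
    \forall w \near u, vpair (tan_at s a w, xi s w) z = 0.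
  move=> Hz; apply: near_crd oU Uq aq _ => q' aq' Uq'.
  by rewrite -[RHS](Hz q' Uq') /xi /tan_at /cot_at crdK.
(* The sheared twisted bracket is the untwisted bracket of the sheared sections, whose values are
   orthogonal to the constant frame. *)
rewrite (_ : shear _ _ = (tan_at e a u *m grad (tan_at f a) u
      - tan_at f a u *m grad (tan_at e a) u,
    tan_at e a u *m grad (xi f) u + xi f u *m (grad (tan_at e a) u)^T
      - tan_at f a u *m (grad (xi e) u - (grad (xi e) u)^T))); last first.
  rewrite /shear /chart_comp E1 E2 /=; congr (_, _).
  apply: gauge => //.
  - by move=> i l; exact: (dt e i l se).1.
  - by move=> i l; exact: (dt f i l sf).1.
  - by move=> i l; exact: (dt e i l se).2.
  - by move=> i l; exact: (dt f i l sf).2.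
  - exact: aB.
  - exact: BH.
apply: flat_dorfman_orthogonal.
- by move=> i l; exact: (dt e i l se).1.
- by move=> i l; exact: (dt f i l sf).1.
- by move=> i l; exact: dxi.
- by move=> i l; exact: dxi.
- by apply: near_ort => q' Uq'; exact: (Me q' Uq').2.
- by apply: near_ort => q' Uq'; exact: (Mf q' Uq').2.
- apply: near_ort => q' Uq'.
  (* The value of the sheared [f] at [q] is a combination of the [m i] with fixed coefficients, and
     the sheared [e] is orthogonal to every [m i] at all nearby points. *)
  have [iso maxi _] := m_frame.
  have [c Ec] := maxi _ (Mf q Uq).2.
  have -> : (tan_at f a u, xi f u) = \sum_i c i *: m i.
    by rewrite -Ec /xi /tan_at /cot_at crdK.
  by rewrite vpairC vpair_suml big1 // => i _; rewrite vpairC (Me q' Uq').2 mulr0.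
Qed.

(** The matrix expresses, in the basis [s] of the fibre of [L], the equations that cut out the
    gauged fibre. Its invertibility makes the intersection trivial and lets any vector be corrected
    by an element of [L] so as to satisfy these equations. *)
Lemma gauged_complementary L (s : 'I_k -> X -> gvec X) :
  (forall q e, U q -> L q e -> gtangent q e) -> (forall q, U q -> spans s L q) ->
  (forall q, U q -> \det (\matrix_(i, j)
     vpair (shear (B (crd_ a q)) (chart_comp a (s i q))) (m j)) != 0) ->
  complementary U L (gauged a B m).
Proof.
move=> Lt Ls dP q Uq; have aq := Ua Uq; have [spE free] := Ls q Uq.
have dPq := dP q Uq; set P := \matrix_(i, j) _ in dPq *.
have ts i : gtangent q (s i q) by exact/Lt/(span_mem i (Ls q Uq)).
have PE (c : 'I_k -> R) j :
    vpair (shear (B (crd_ a q)) (chart_comp a (\sum_i c i *: s i q))) (m j) =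
    ((\row_i c i) *m P) 0 j.
  rewrite comp_sum shear_sum vpair_suml mxE; apply: eq_bigr => i _.
  by rewrite !mxE.
have uP : P \in unitmx by rewrite unitmxE unitfE.
split.
  apply/seteqP; split=> [e [/spE[c Ec] [_ He]]|_ ->].
    have : \row_i c i = 0 :> 'rV[R]_k.
      rewrite -[LHS](mulmxK uP) (_ : _ *m P = 0) ?mul0mx //.
      by apply/rowP => j; rewrite -PE -Ec He mxE.
    move/rowP => c0; rewrite Ec /= big1 // => i _.
    by have := c0 i; rewrite !mxE => ->; rewrite scale0r.
  split.
    by apply/spE; exists (fun=> 0); rewrite big1 // => i _; rewrite scale0r.
  split=> [|j]; first exact: gtangent0.
  by rewrite comp0 shear0 -(scale0r (0 : vec)) vpairZl mul0r.
apply/seteqP; split=> [e te|_ [l [e [Ll [te _] ->]]]]; last first.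
  by apply: gtangentD => //; exact: Lt Ll.
pose d := \row_j vpair (shear (B (crd_ a q)) (chart_comp a e)) (m j).
pose c i := (d *m invmx P) 0 i.
have dc : \row_i c i *m P = d.
  by rewrite -[RHS](mulmxKV uP); congr (_ *m _); apply/rowP => i; rewrite mxE.
pose l := \sum_i c i *: s i q.
have tl : gtangent q l by exact: gtangent_sum.
exists l, (e - l); split; last by rewrite addrC subrK.
  by apply/spE; exists c.
rewrite -scaleN1r; split=> [|j]; first by apply: gtangentD => //; exact: gtangentZ.
rewrite compD compZ shearD shearZ vpairDl vpairZl PE dc mxE; ring.
Qed.

End gauged_structure.

End local_complements.

Lemma open_crd_preimage (X : topologicalType) (R : realType) (n : nat)
    (ch : chart R n X) (O : set 'rV[R]_n) :
  open O -> open (dom ch `&` crd ch @^-1` O).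
Proof.
move=> oO; rewrite openE => p [dp Op].
have cp := crd_nbhs dp.
have nO : nbhs p (crd ch @^-1` O) := cp _ (open_nbhs_nbhs (conj oO Op)).
exact: filterI (open_nbhs_nbhs (conj (@open_dom _ _ _ ch) dp)) nO.
Qed.

Theorem proposition2p24 (R : realType) (n : nat) (X : manifold R n)
    (H : tensor3 X) (H_form : is_3form H) (H_closed : closed_3form H)
    (L : X -> set (gvec X)) (L_dirac : is_dirac setT H L) (p : X) :
  exists (U : set X) (M : X -> set (gvec X)),
    [/\ open U, U p, is_dirac U H M & complementary U L M].
Proof.
have [LL _] := L_dirac.
have [V [k [s [oV Vp _ sec fr]]]] := LL.1 p I.
have [a ap] := atlas_cover p.
have sp q : V q -> spans s L q := fr q.
pose b i := chart_comp a (s i p).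
have b_frame : lagrangian_frame b := span_frame LL I ap (sp p Vp).
pose m i := swap (b i).
have m_frame : lagrangian_frame m := swap_frame b_frame.
pose u0 := crd (atlas a) p.
pose W := crd (atlas a) @` (dom (atlas a) `&` V).
have oW : open W by exact: open_crd.
have Wu0 : W u0 by exists p.
(* A ball centred at [u0] is star-shaped about [u0], as the cone operator requires. *)
have /nbhs_ballP[r /= r0 rW] := open_nbhs_nbhs (conj oW Wu0).
have oB : open (ball u0 r) by exact: ball_open.
have u0B : ball u0 r u0 by exact: ballxx.
pose Ha i j l u := H (par (atlas a) u) a i j l.
have HaE q : dom (atlas a) q -> forall i j l, Ha i j l (crd (atlas a) q) = H q a i j l.
  by move=> aq i j l; rewrite /Ha crdK.
have sHa i j l : csmooth (ball u0 r) (Ha i j l).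
  have [_ _ /(_ a i j l)] := H_form; rewrite smoothE; apply: smooth_sub.
  by move=> u /rW[q [aq _] <-]; exists q.
have [B [sB aB B0 dB]] : exists B : 'I_n -> 'I_n -> 'rV[R]_n -> R,
  [/\ forall i j, csmooth (ball u0 r) (B i j),
      forall u, ball u0 r u -> forall i j, B i j u = - B j i u,
      forall i j, B i j u0 = 0 &
      forall u, ball u0 r u -> forall i j k,
        pderiv i (B j k) u - pderiv j (B i k) u + pderiv k (B i j) u = Ha i j k u].
  apply: poincare3 => // [u /rW[q [aq _] <-] i j l|u /rW[q [aq _] <-] i j l e].
    rewrite !HaE //; have [_ aH _] := H_form; exact: aH.
  by have := H_closed a q aq i j l e; rewrite /= partialE.
pose Bm u := \matrix_(i, j) B i j u.
(* The matrix that decides complementarity, written as a function of the coordinates so that its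
   smoothness can be used. *)
pose P u := \matrix_(i, j)
  vpair (shear (Bm u) (tan_at (s i) a u, cot_at (s i) a u)) (m j).
have Bm0 : Bm u0 = 0 by apply/matrixP => i j; rewrite !mxE B0.
have sBm i j : csmooth (ball u0 r) (fun u => Bm u i j).
  by under eq_fun do rewrite mxE.
have sP i j : csmooth (ball u0 r) (fun u => P u i j).
  have st l : csmooth (ball u0 r) (fun u => tan_at (s i) a u 0 l) /\
      csmooth (ball u0 r) (fun u => cot_at (s i) a u 0 l).
    have [s1 s2] := section_csmooth a l (sec i).
    by split; [exact: smooth_sub s1|exact: smooth_sub s2].
  rewrite (_ : (fun u => _) = (fun u =>
      \sum_l cst ((m j).2 0 l) u * tan_at (s i) a u 0 l +
      \sum_l (cot_at (s i) a u 0 l + \sum_h tan_at (s i) a u 0 h * Bm u h l)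
         * cst ((m j).1 0 l) u)); last first.
    apply/funext => u; rewrite mxE /vpair !dotE /=; congr (_ + _).
    by apply: eq_bigr => l _; rewrite !mxE.
  apply: smoothD => //; apply: smooth_sum => // l; apply: smoothM => //.
  - exact: smooth_cst.
  - exact: (st l).1.
  - apply: smoothD => //; first exact: (st l).2.
    by apply: smooth_sum => // h; apply: smoothM => //; exact: (st h).1.
  - exact: smooth_cst.
(* B vanishes at [u0], so there [P] is the Euclidean Gram matrix of a basis of the fibre of [L]. *)
have P0 : \det (P u0) != 0.
  rewrite (_ : P u0 = \matrix_(i, j) vpair (b i) (swap (b j))).
    exact: frame_gram_det.
  apply/matrixP => i j; rewrite !mxE Bm0 /shear mulmx0 addr0 /=.
  by rewrite /tan_at /cot_at /u0 crdK.
have cP : {for u0, continuous (fun u => \det (P u))}.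
  exact: smooth_continuous (smooth_det oB sP) u0B.
have : \forall u \near u0, ball u0 r u /\ \det (P u) != 0.
  have A : \forall u \near u0, \det (P u) != 0.
    have A : nbhs (\det (P u0)) [set x : R | x != 0].
      by apply: open_nbhs_nbhs; split => //; exact: open_neq.
    exact: cP _ A.
  exact: filterI (open_nbhs_nbhs (conj oB u0B)) A.
case/nbhs_ballP => r' /= r'0 r'P.
(* On [U] the chart [a] is available, B is a primitive of H, the determinant of [P] is nonzero and
   [s] spans [L]. *)
pose U := dom (atlas a) `&` crd (atlas a) @^-1` (ball u0 r') `&` V.
have oU : open U by apply: openI => //; apply: open_crd_preimage; exact: ball_open.
have UB q : U q -> ball u0 r (crd (atlas a) q) by move=> [[_ /r'P[]]].
have UW : crd (atlas a) @` (dom (atlas a) `&` U) `<=` ball u0 r.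
  by move=> _ [q [_ Uq] <-]; exact: UB.
have Ua : U `<=` dom (atlas a) by move=> q [[]].
have aBm q : U q -> (Bm (crd (atlas a) q))^T = - Bm (crd (atlas a) q).
  by move=> Uq; apply/matrixP => i j; rewrite !mxE aB //; exact: UB.
exists U, (gauged a Bm m); split => //.
- by split => //; split => //=; exact: ballxx.
- apply: gauged_dirac => //.
    by move=> i j; exact: smooth_sub (sBm i j).
  move=> q Uq i j l; rewrite -HaE; last exact: Ua.
  have BmE x y : (fun w => Bm w x y) = B x y by apply/funext => w; rewrite mxE.
  by rewrite !BmE dB //; exact: UB.
- apply: gauged_complementary => //.
  + by move=> q e _; exact: lagrangian_gtangent LL I.
  + by move=> q [_ Vq]; exact: sp.
  + move=> q Uq; have [[aq /r'P[_ dP]] _] := Uq.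
    by move: dP; congr (is_true (\det _ != 0)); apply/matrixP => i j; rewrite !mxE /tan_at /cot_at crdK.
Qed.
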